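(* Let $G$ be a second countable locally compact Abelian group containing a compact open subgroup $H\subseteq G$. Let $\bigcup_{j\in J}\{T_\gamma g_{j,p}\}_{\gamma\in\Gamma_j,\,p\in P_j}$ be a generalised translation-invariant system in $L^2(G)$. Then the following assertions are equivalent: (i) The system $\bigcup_{j\in J}\{T_\gamma g_{j,p}\}_{\gamma\in\Gamma_j,\,p\in P_j}$ satisfies the local integrability condition with respect to $E=\emptyset$. (ii) $$\sum_{j\in J}\frac1{\mathrm{d}_H(\Gamma_j)}\int_{P_j}|\hat g_{j,p}(\cdot)|^2\,d\mu_{P_j}(p)\in L^1_{\mathrm{loc}}(\widehat G),$$ where $\mathrm{d}_H(\Gamma_j):=\mu_{H\Gamma_j/\Gamma_j}(H\Gamma_j/\Gamma_j)$.
   Context: $G$ is a second countable locally compact Hausdorff Abelian group, written additively, with Haar measure $\mu_G$ normalised so that $\mu_G(H)=1$; $\widehat G$ is its Pontryagin dual, written multiplicatively, with the Plancherel Haar measure $\mu_{\widehat G}$ relative to $\mu_G$. $\hat f$ is the Fourier–Plancherel transform of $f\in L^2(G)$, and $T_\gamma f = f(\cdot-\gamma)$. For a closed subgroup $\Gamma\subseteq G$, $\Gamma^\perp=\{\omega\in\widehat G: \omega(x)=1\ \forall x\in\Gamma\}$. $\Gamma$ is co-compact if $G/\Gamma$ is compact. Each translation subgroup $\Gamma$ carries a given Haar measure $\mu_\Gamma$ (the counting measure if $\Gamma$ is a uniform lattice, i.e. discrete and co-compact). For closed subgroups $\Gamma \subseteq \Lambda\subseteq G$ with given Haar measures, $\Lambda/\Gamma$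 carries the Haar measure making Weil's formula $\int_\Lambda f\,d\mu_\Lambda=\int_{\Lambda/\Gamma}\int_\Gamma f(x+\gamma)\,d\mu_\Gamma(\gamma)\,d\mu_{\Lambda/\Gamma}(\dot x)$ hold. The covolume is $\mathrm{d}(\Gamma)=\mu_{G/\Gamma}(G/\Gamma)$. $H\Gamma_j=\{h+\gamma: h\in H,\gamma\in\Gamma_j\}$ is an open (hence closed) subgroup of $G$; its Haar measure is the one for which, via Weil's formula, the finite group $G/H\Gamma_j$ carries the counting measure (i.e. the restriction of $\mu_G$), and $\mu_{H\Gamma_j/\Gamma_j}$ is then determined by $\mu_{H\Gamma_j}$ and $\mu_{\Gamma_j}$ via Weil's formula. Generalised translation-invariant (GTI) system: $J$ is countable; for each $j\in J$, $\Gamma_j\subseteq G$ is a closed, co-compact subgroup and $P_j$ is an index set with functions $g_{j,p}\in L^2(G)$, $p\in P_j$; the system is $\bigcup_{j\in J}\{T_\gamma g_{j,p}:\gamma\in\Gamma_j,p\in P_j\}$. Standing hypotheses for each $j$: (I) $(P_j,\Sigma_{P_j},\mu_{P_j})$ is a $\sigma$-finite measure space; (II) $p\mapsto g_{j,p}$ is measurable from $(P_j,\Sigma_{P_j})$ to $L^2(G)$ with its Borel $\sigma$-algebra; (III) $(p,x)\mapsto g_{j,p}(x)$ is $\Sigma_{P_j}\otimes\mathcal B_G$-measurable. Local integrability condition with respect to $E=\emptyset$: for all $f\in L^2(G)$ such that $\hat f\in L^\infty(\widehat G)$ has compact support, $$\sum_{j\in J}\frac1{\mathrm{d}(\Gamma_j)}\int_{P_j}\sum_{\alpha\in\Gamma_j^\perp}\int_{\operatorname{supp}\hat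 f}|\hat f(\omega\alpha)\hat g_{j,p}(\omega)|^2\,d\mu_{\widehat G}(\omega)\,d\mu_{P_j}(p)<\infty.$$ Equivalently, for all compact $K\subseteq\widehat G$, $\sum_{j\in J}\frac1{\mathrm{d}(\Gamma_j)}\int_{P_j}\sum_{\alpha\in\Gamma_j^\perp}\int_{K\cap\alpha^{-1}K}|\hat g_{j,p}(\omega)|^2\,d\mu_{\widehat G}(\omega)\,d\mu_{P_j}(p)<\infty$. *)

(* Defs.v *)
From HB Require Import structures.
From mathcomp Require Import all_boot all_order all_algebra ring_quotient.
From mathcomp Require Import all_classical all_reals all_analysis.
From mathcomp Require Import measurable_realfun complex.

Set Implicit Arguments.
Unset Strict Implicit.
Unset Printing Implicit Defensive.
Import Order.TTheory GRing.Theory Num.Theory.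
Import numFieldNormedType.Exports.
Local Open Scope classical_set_scope.
Local Open Scope ring_scope.
Local Open Scope quotient_scope.

(* All groups below (G, its subgroups, quotients and dual) are Abelian and are
   Z-modules with a topology, so the group law is always written +, including
   that of the dual group (whose law is pointwise multiplication). *)
Notation preTopologicalZmodType := PreTopologicalZmodule.type.

Definition pointed_zmod (T : Type) : Type := T.
HB.instance Definition _ (T : zmodType) := GRing.Zmodule.on (pointed_zmod T).
HB.instance Definition _ (T : zmodType) := isPointed.Build (pointed_zmod T) 0.

Definition borel (T : preTopologicalZmodType) : Type :=
  g_sigma_algebraType (@open T : set (set (pointed_zmod T))).
HB.instance Definition _ (T : preTopologicalZmodType) :=
  Measurable.copy (borel T)
    (g_sigma_algebraType (@open T : set (set (pointed_zmod T)))).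

Section Subgroup.
Variables (G : preTopologicalZmodType) (S : zmodClosed G).

Definition subgroup : Type := {x : G | x \in S}.
HB.instance Definition _ := [isSub of subgroup for @sval G (fun x => x \in S)].
HB.instance Definition _ := [Choice of subgroup by <:].
HB.instance Definition _ := [SubChoice_isSubZmodule of subgroup by <:].
HB.instance Definition _ :=
  Topological.copy subgroup (initial_topology (\val : subgroup -> G)).

Definition quotient : Type := quotient_topology (Quotient.quot S).
HB.instance Definition _ := Topological.on quotient.
HB.instance Definition _ := GRing.isZmodule.Build quotient
  (@Quotient.addqA G S) (@Quotient.addqC G S) (@Quotient.add0q G S)
  (@Quotient.addNq G S).

End Subgroup.

Section HaarMeasure.
Variable R : realType.
Local Open Scope ereal_scope.

(* Regularity is automatic here, all groups being second countable. *)
Definition is_haar (T : preTopologicalZmodType)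
    (mu : {measure set (borel T) -> \bar R}) : Prop :=
  [/\ forall (a : T) (A : set (borel T)), measurable A ->
        mu [set x : T | A (a + x)%R] = mu A,
      forall K : set T, compact K -> mu K < +oo &
      forall U : set T, open U -> U !=set0 -> 0 < mu U].

(* Weil's formula for the subgroup S of L, where S carries the image of muN
   under the isomorphism i of N onto S. It is stated for nonnegative Borel
   functions, from which the formula for integrable functions follows. *)
Definition weil (L N : preTopologicalZmodType) (S : zmodClosed L) (i : N -> L)
    (muL : {measure set (borel L) -> \bar R})
    (muN : {measure set (borel N) -> \bar R})
    (muQ : {measure set (borel (quotient S)) -> \bar R}) : Prop :=
  forall f : borel L -> \bar R, measurable_fun [set: borel L] f ->
    (forall x, 0 <= f x) ->
    \int[muL]_x f x =
    \int[muQ]_q \int[muN]_n f (repr (q : quotient S) + i n)%R.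

End HaarMeasure.

Section SubgroupSum.
Variables (G : preTopologicalZmodType) (H K : zmodClosed G).

Definition subgroup_sum_pred : {pred G} :=
  mem [set h + k | h in [set` H] & k in [set` K]].

Fact subgroup_sum_closed : zmod_closed subgroup_sum_pred.
Proof.
split=> [|x y]; rewrite !inE.
  by exists 0; [exact: rpred0|exists 0; [exact: rpred0|rewrite addr0]].
move=> [h Hh [k Kk <-]] [h' Hh' [k' Kk' <-]].
exists (h - h'); first exact: rpredB.
by exists (k - k'); [exact: rpredB|rewrite opprD addrACA].
Qed.
HB.instance Definition _ :=
  GRing.isZmodClosed.Build G subgroup_sum_pred subgroup_sum_closed.
Definition subgroup_sum : zmodClosed G := subgroup_sum_pred.

Fact sub_subgroup_sumr : {subset K <= subgroup_sum}.
Proof.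
by move=> k Kk; rewrite inE; exists 0; [exact: rpred0|exists k; rewrite ?add0r].
Qed.

Definition subgroup_sumr (k : subgroup K) : subgroup subgroup_sum :=
  Sub (\val k) (sub_subgroup_sumr (valP k)).

(* K viewed as a subgroup of H + K *)
Definition sumr_pred : {pred subgroup subgroup_sum} := [pred x | \val x \in K].
Fact sumr_closed : zmod_closed sumr_pred.
Proof.
by split=> [|x y]; rewrite !inE ?raddf0 ?rpred0// raddfB; exact: rpredB.
Qed.
HB.instance Definition _ :=
  GRing.isZmodClosed.Build (subgroup subgroup_sum) sumr_pred sumr_closed.
Definition sumr : zmodClosed (subgroup subgroup_sum) := sumr_pred.

End SubgroupSum.

Section Dual.
Variables (R : realType) (G : preTopologicalZmodType).

Definition is_character (chi : G -> R[i]) : Prop :=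
  [/\ continuous (chi : G -> R[i]^o),
      forall x y, chi (x + y) = chi x * chi y &
      forall x, `|chi x| = 1].

Definition dual : Type := {chi : G -> R[i] | `[< is_character chi >]}.
HB.instance Definition _ :=
  [isSub of dual for @sval (G -> R[i]) (fun chi => `[< is_character chi >])].
HB.instance Definition _ := gen_eqMixin dual.
HB.instance Definition _ := gen_choiceMixin dual.

Definition character (w : dual) : G -> R[i] := \val w.
Coercion character : dual >-> Funclass.

Lemma characterP (w : dual) : is_character w.
Proof. exact/asboolP/(valP w). Qed.

Lemma dual_eqP (v w : dual) : (v : G -> R[i]) =1 w -> v = w.
Proof. by move=> vw; apply/val_inj/funext. Qed.

Lemma character_neq0 (w : dual) x : w x != 0.
Proof. by have [_ _ w1] := characterP w; rewrite -normr_eq0 w1 oner_eq0. Qed.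

Fact dual0_subproof : is_character (fun=> 1).
Proof.
by split=> [x|x y|x]; [exact: cvg_cst|rewrite mulr1|rewrite normr1].
Qed.
Fact dualN_subproof (w : dual) : is_character (fun x => (w x)^-1).
Proof.
have [wc wD w1] := characterP w; split=> [x|x y|x].
- by apply: (@cvgV R[i]) (wc x); exact: character_neq0.
- by rewrite wD invfM.
- by rewrite normfV w1 invr1.
Qed.
Fact dualD_subproof (v w : dual) : is_character (fun x => v x * w x).
Proof.
have [vc vD v1] := characterP v; have [wc wD w1] := characterP w.
split=> [x|x y|x].
- exact: (@cvgM R[i]) (vc x) (wc x).
- by rewrite vD wD mulrACA.
- by rewrite normrM v1 w1 mulr1.
Qed.

Definition dual0 : dual := Sub (fun=> 1) (asboolT dual0_subproof).
Definition dualN (w : dual) : dual :=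
  Sub (fun x => (w x)^-1) (asboolT (dualN_subproof w)).
Definition dualD (v w : dual) : dual :=
  Sub (fun x => v x * w x) (asboolT (dualD_subproof v w)).

Fact dualDA : associative dualD.
Proof. by move=> u v w; apply: dual_eqP => x; exact: mulrA. Qed.
Fact dualDC : commutative dualD.
Proof. by move=> v w; apply: dual_eqP => x; exact: mulrC. Qed.
Fact dual0D : left_id dual0 dualD.
Proof. by move=> w; apply: dual_eqP => x; exact: mul1r. Qed.
Fact dualND : left_inverse dual0 dualN dualD.
Proof. by move=> w; apply: dual_eqP => x; exact/mulVf/character_neq0. Qed.
HB.instance Definition _ := GRing.isZmodule.Build dual dualDA dualDC dual0D dualND.

HB.instance Definition _ := Topological.copy dual
  (initial_topology (character : dual -> {compact-open, G -> R[i]^o})).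

Definition annihilator (S : zmodClosed G) : set dual :=
  [set w | forall x, x \in S -> w x = 1].

End Dual.

Section Complex_functions.
Context d (T : measurableType d) (R : realType).
Implicit Types (mu : {measure set T -> \bar R}) (f : T -> R[i]).
Local Open Scope ereal_scope.

Definition cmeasurable f : Prop :=
  measurable_fun [set: T] (fun x => complex.Re (f x)) /\
  measurable_fun [set: T] (fun x => complex.Im (f x)).

Definition cLnorm mu (p : \bar R) f : \bar R :=
  'N[mu]_p[(fun x => (Normc.normc (f x))%:E)].

Definition cLfun mu (p : \bar R) : set (T -> R[i]) :=
  [set f | cmeasurable f /\ cLnorm mu p f < +oo].

Definition cintegral mu f : R[i] :=
  Complex (\int[mu]_x complex.Re (f x))%R (\int[mu]_x complex.Im (f x))%R.

(* Sets of functions whose trace on L^2(mu) is open for the L^2 seminorm; such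
   traces are saturated for a.e. equality, hence are the open sets of the
   quotient Hilbert space. *)
Definition L2_open mu : set (set (T -> R[i])) :=
  [set U | forall f, cLfun mu 2%:E f -> U f ->
    exists2 e : R, (0 < e)%R & forall h, cLfun mu 2%:E h ->
      cLnorm mu 2%:E (h \- f)%R < e%:E -> U h].

End Complex_functions.

Section Fourier.
Variables (R : realType) (G : preTopologicalZmodType).
Variables (mu : {measure set (borel G) -> \bar R}).
Variables (nu : {measure set (borel (dual R G)) -> \bar R}).
Local Open Scope ereal_scope.

Definition fourier (f : borel G -> R[i]) (w : borel (dual R G)) : R[i] :=
  cintegral mu (fun x : borel G => f x * conjc ((w : dual R G) x))%R.

Definition is_plancherel_measure : Prop :=
  is_haar nu /\
  forall f, cLfun mu 1 f -> cLfun mu 2%:E f ->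
    cLnorm nu 2%:E (fourier f) = cLnorm mu 2%:E f.

(* F is a representative of the Fourier-Plancherel transform of f: the latter
   is the extension by continuity of the Fourier transform from the dense
   subspace L^1 `&` L^2 of L^2. *)
Definition is_fourier_plancherel (f : borel G -> R[i])
    (F : borel (dual R G) -> R[i]) : Prop :=
  cLfun nu 2%:E F /\
  exists f_ : (borel G -> R[i])^nat,
    [/\ forall n, cLfun mu 1 (f_ n) /\ cLfun mu 2%:E (f_ n),
        cLnorm mu 2%:E (f_ n \- f)%R @[n --> \oo] --> 0 &
        cLnorm nu 2%:E (fourier (f_ n) \- F)%R @[n --> \oo] --> 0].

(* support of an a.e. class *)
Definition ess_supp (F : borel (dual R G) -> R[i]) : set (dual R G) :=
  [set w | forall U : set (dual R G), open U -> U w ->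
    0 < nu (U `&` [set v | F v != 0%R])].

Definition L1_loc (F : borel (dual R G) -> \bar R) : Prop :=
  forall K : set (dual R G), compact K -> nu.-integrable K F.

End Fourier.

Definition covolume (R : realType) (T : preTopologicalZmodType)
  (mu : {measure set (borel T) -> \bar R}) : \bar R := mu [set: borel T].

(* The system consists of the functions x |-> gti_g j p (x - gamma), where
   j : J, gamma \in gti_Gamma j and p : gti_P j. *)
Record gti_system (R : realType) (G : preTopologicalZmodType)
    (mu : {measure set (borel G) -> \bar R}) (J : countType) := GtiSystem {
  gti_Gamma : J -> zmodClosed G ;
  gti_closed : forall j, closed [set` gti_Gamma j] ;
  gti_cocompact : forall j, compact [set: quotient (gti_Gamma j)] ;
  gti_muGamma : forall j, {measure set (borel (subgroup (gti_Gamma j))) -> \bar R} ;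
  gti_haar : forall j, is_haar (gti_muGamma j) ;
  gti_lattice : forall j,
    (forall x : subgroup (gti_Gamma j), open [set x]) ->
    forall A, measurable A -> gti_muGamma j A = counting A ;
  gti_disp : J -> measure_display ;
  gti_P : forall j, measurableType (gti_disp j) ;
  gti_muP : forall j, {sigma_finite_measure set (gti_P j) -> \bar R} ;
  gti_g : forall j, gti_P j -> borel G -> R[i] ;
  gti_L2 : forall j p, cLfun mu 2%:E (@gti_g j p) ;
  gti_measurable_L2 : forall j A, <<s L2_open mu >> A ->
    measurable (@gti_g j @^-1` A) ;
  gti_measurable : forall j,
    cmeasurable (fun px : (gti_P j * borel G)%type => @gti_g j px.1 px.2)
}.

Arguments gti_g {R G mu J} _ {j} p.

Section LocalIntegrability.
Variables (R : realType) (G : preTopologicalZmodType).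
Variables (mu : {measure set (borel G) -> \bar R}).
Variables (nu : {measure set (borel (dual R G)) -> \bar R}).
Variables (J : countType) (S : gti_system mu J).
Local Open Scope ereal_scope.

(* ghat j p is a representative of the Fourier-Plancherel transform of
   gti_g S p. Each transform is an a.e. class; the representatives have to be
   chosen jointly measurable in (p, w) for the integral over gti_P S j of
   |ghat j p w|^2, at a given w, to make sense. *)
Definition is_gti_transform
    (ghat : forall j, gti_P S j -> borel (dual R G) -> R[i]) : Prop :=
  (forall j p, is_fourier_plancherel mu nu (gti_g S p) (ghat j p)) /\
  (forall j, cmeasurable
     (fun pw : (gti_P S j * borel (dual R G))%type => ghat j pw.1 pw.2)).

(* local integrability condition with respect to the empty set *)
Definition local_integrability (d : J -> \bar R)
    (ghat : forall j, gti_P S j -> borel (dual R G) -> R[i]) : Prop :=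
  forall (f : borel G -> R[i]) (F : borel (dual R G) -> R[i]),
    cLfun mu 2%:E f -> is_fourier_plancherel mu nu f F ->
    cLfun nu +oo F -> compact (ess_supp nu F) ->
    \esum_(j in [set: J]) ((d j)^-1 * \int[gti_muP S j]_p
      \esum_(a in annihilator (gti_Gamma S j))
        \int[nu]_(w in (ess_supp nu F : set (borel (dual R G))))
          ((Normc.normc (F ((w : dual R G) + a) * ghat j p w)) ^+ 2)%:E)
    < +oo.

Definition weighted_transform_sum (d : J -> \bar R)
    (ghat : forall j, gti_P S j -> borel (dual R G) -> R[i])
    (w : borel (dual R G)) : \bar R :=
  \esum_(j in [set: J]) ((d j)^-1 * \int[gti_muP S j]_p
    ((Normc.normc (ghat j p w)) ^+ 2)%:E).

End LocalIntegrability.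

(* Main.v *)
(** Write D for the dual of G and A_S for the annihilator of a subgroup S. As H is
    compact and open, so is A_H in D. The restriction to H of a character w0 is
    the inverse transform of the indicator of w0 + A_H, whose L^2 class is
    therefore a test function for the local integrability condition. For it, an
    element a of A_Gamma contributes to the sum exactly when it lies in A_H, and
    A_Gamma `&` A_H = A_(H + Gamma) has N elements, with N the index of H + Gamma
    in G. For a general test function with transform F supported in a compact set
    covered by m cosets of A_H, an element of A_Gamma can only contribute if it
    lies in one of m^2 cosets of A_H, each of which contains at most N elements of
    A_Gamma. Finally, Weil's formula gives d(Gamma) = N d_H(Gamma), so that N
    cancels, and the sum and integrals are exchanged by Tonelli's theorem. *)
Require Import Defs.
From HB Require Import structures.
From mathcomp Require Import all_boot fingroup action pgroup center.
From mathcomp Require Import mxrepresentation.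
From mathcomp Require Import all_boot all_order all_algebra ring_quotient.
From mathcomp Require Import all_classical all_reals all_analysis.
From mathcomp Require Import measurable_realfun complex finmap ess_sup_inf.
From mathcomp Require Import ring lra.

Set Implicit Arguments.
Unset Strict Implicit.
Unset Printing Implicit Defensive.
Import Order.TTheory GRing.Theory Num.Theory.
Import numFieldNormedType.Exports.
Local Open Scope classical_set_scope.
Local Open Scope ring_scope.

(** * Characters of finite abelian groups *)

(** Duality enters only through elementary facts on annihilators. That of [H] is open because the
    circle has no small subgroups, and compact by taking limits of characters along ultrafilters.
    The N characters of the finite group G / (H + Gamma) are counted by representation theory: a
    finite abelian group has as many complex irreducible representations as elements, all of degree
    1. Three measure-theoretic obstacles shape the rest. A transform must vanish almost everywhere
    off its essential support, which takes a Lindelof property of the dual, derived from a countable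
    base of [G]. The measure on the dual is not given as sigma-finite, so Tonelli's theorem is
    applied over sets of finite measure: cosets of the annihilator of [H], or compact supports. The
    sum over the annihilator of Gamma is not known to be measurable in [p]: for the indicator of a
    coset it is computed exactly, and for a general test function it is only compared with a
    measurable bound. *)

Lemma abelian_irr_scalar (gT : finGroupType) (F : closedFieldType) n
    (G : {group gT}) (rG : mx_representation F G n.+1) :
    abelian G -> mx_irreducible rG ->
  {in G, forall x, is_scalar_mx (rG x)}.
Proof.
move=> cGG irrG x Gx.
have /closed_rootP[a] : size (char_poly (rG x)) != 1%N by rewrite size_char_poly.
rewrite -eigenvalue_root_char => /eigenvalueP[v va v0].
(* Schur's lemma: [rG x - a%:M] commutes with the representation, so it is invertible unless it
   vanishes; the eigenvector [v] rules out invertibility. *)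
apply/is_scalar_mxP; exists a; apply/eqP; rewrite -subr_eq0.
apply: contraNT v0 => nz.
have U : rG x - a%:M \in unitmx.
  apply: (mx_Schur irrG) nz; apply/centgmxP => y Gy.
  by rewrite mulmxBl mulmxBr -!repr_mxM // (centsP cGG) // scalar_mxC.
rewrite -(mulmxK U v) mulmxBr va mul_mx_scalar subrr mul0mx //.
Qed.

(** Scalar matrices preserve every line, so an irreducible module is a line, and a representation of
    degree 1 is absolutely irreducible. *)
Lemma abelian_splitting_field (gT : finGroupType) (F : closedFieldType)
    (G : {group gT}) :
  abelian G -> group_splitting_field F G.
Proof.
move=> cGG [|n] rG irrG; first by case/mx_irrP: irrG.
apply: linear_mx_abs_irr.
pose M := <<delta_mx 0 0 : 'rV[F]_n.+1>>%MS.
have linM: \rank M = 1 by rewrite genmxE mxrank_delta.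
have modM: mxmodule rG M.
  apply/mxmoduleP=> x Gx; have /is_scalar_mxP[a ->] := abelian_irr_scalar cGG irrG Gx.
  by rewrite scalar_mxC submxMl.
apply/eqP; rewrite eq_sym -linM.
by case/mx_irrP: irrG => _; apply; rewrite // -mxrank_eq0 linM.
Qed.

(** In characteristic 0 the irreducible representations are as many as the conjugacy classes, here
    the elements of [U]. They have degree 1, hence are characters; conversely a character is a
    representation by 1 x 1 matrices, for which similarity is equality. *)
Lemma finite_characters (U : finZmodType) (F : closedFieldType) :
    [pchar F] =i pred0 ->
  exists s : seq {ffun U -> F}, [/\ uniq s, size s = #|U| &
    forall chi : {ffun U -> F}, chi \in s <->
      chi 0 = 1 /\ {morph chi : x y / x + y >-> x * y}].
Proof.
move=> F0; pose G : {group U} := [set: U]%G.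
have cGG : abelian G by exact: FinRing.zmod_abelian.
have splitG : group_splitting_field F G by exact: abelian_splitting_field.
have F'G : ([pchar F]^'.-group G)%g.
  by apply/pgroupP => p _ _; rewrite inE /= [p \in _]F0.
pose sG : irrType F G := DecSocleType _.
have Z x : x \in 'Z(G)%g by rewrite (center_idP cGG) inE.
pose c (i : sG) := [ffun x => irr_mode i x].
have lin (i : sG) : irr_degree i = 1%N by exact: irr_degree_abelian.
have scal (i : sG) x : irr_repr i x = (c i x)%:M.
  by rewrite ffunE; exact: irr_center_scalar.
have c_inj : injective c.
  move=> V W eqVW; rewrite -(irr_reprK_pchar F'G V) -(irr_reprK_pchar F'G W).
  move: (irr_repr V) (irr_repr W) (scal V) (scal W).
  rewrite !lin {}eqVW => rV rW rVc rWc; apply: irr_comp_rsim_pchar => //.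
  exists 1%:M; rewrite ?row_free_unit ?unitmx1 // => x _.
  by rewrite mulmx1 mul1mx rVc rWc.
exists (map c (enum sG)); split.
- by rewrite map_inj_uniq ?enum_uniq.
- rewrite size_map -cardE card_irr_pchar //.
  by rewrite (eqP (etrans (esym (card_classes_abelian _)) cGG)) cardsT.
move=> chi; split.
  move=> /mapP[i _ ->]; split; first by rewrite ffunE -FinRing.zmod1gE irr_mode1.
  by move=> x y; rewrite !ffunE -FinRing.zmodMgE irr_modeM.
move=> [chi0 chiD].
have rP : mx_repr G (fun x => (chi x)%:M : 'M[F]_1).
  by split=> [|x y _ _]; rewrite ?FinRing.zmod1gE ?chi0// FinRing.zmodMgE chiD scalar_mxM.
pose rG := MxRepresentation rP.
have irrG : mx_irreducible rG by apply/mx_abs_irrW/linear_mx_abs_irr.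
apply/mapP; exists (irr_comp sG rG); rewrite ?mem_enum//.
have [B _ Bfree hB] := rsim_irr_comp_pchar sG F'G irrG.
apply/ffunP => x; have := hB x (finset.in_setT _).
rewrite scal /= mul_scalar_mx mul_mx_scalar => /eqP.
rewrite -subr_eq0 -scalerBl scaler_eq0 subr_eq0 => /orP[/eqP//|/eqP B0].
by move: Bfree; rewrite B0 /row_free mxrank0.
Qed.

(** * Topology of the dual group *)

Lemma compact_finite_cover (T : topologicalType) (A : set T) :
  compact A -> cover_compact A.
Proof.
have [->|/set0P[x _]] := eqVneq A set0.
  by move=> _ I D f _ _; exists fset0.
pose pT : ptopologicalType := HB.pack T (isPointed.Build T x).
by move=> cA; have : @compact pT A by []; rewrite compact_cover.
Qed.

Section dual_topology.
Variables (R : realType) (G : preTopologicalZmodType).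
Implicit Types (v w : dual R G).

Lemma character_continuous w : continuous (w : G -> R[i]^o).
Proof. by have [] := characterP w. Qed.

Lemma characterD w x y : w (x + y) = w x * w y.
Proof. by have [] := characterP w. Qed.

Lemma norm_character w x : `|w x| = 1.
Proof. by have [] := characterP w. Qed.

Lemma character0 w : w 0 = 1.
Proof.
by apply: (mulIf (character_neq0 w 0)); rewrite -characterD addr0 mul1r.
Qed.

Lemma dual_addE v w x : (v + w : dual R G) x = v x * w x. Proof. by []. Qed.
Lemma dual_oppE w x : (- w : dual R G) x = (w x)^-1. Proof. by []. Qed.

(** The working form of the topology of the dual: uniform convergence on compact sets, which is
    convergence in the compact-open topology as the limit [w] is continuous. *)
Lemma dual_cvgP (F : set_system (dual R G)) w : Filter F ->
  F --> w <-> forall C : set G, compact C -> forall e : R[i], 0 < e ->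
    \forall v \near F, forall x, C x -> `|(v : dual R G) x - w x| < e.
Proof.
move=> FF.
have -> : (F --> w) <-> {compact-open, (@character R G @ F) --> (w : G -> R[i]^o)}.
  split=> [Fw U|Fw U [_ [[B Bo <-]] Bw /filterS]]; last first.
    by apply; apply: Fw; apply: open_nbhs_nbhs.
  rewrite nbhsE => -[B [Bo Bw] BU]; have : F (@character R G @^-1` B); last first.
    by apply: filterS => v /BU.
  by apply: Fw; apply: open_nbhs_nbhs; split => //; exists B.
have cw := @character_continuous w.
apply: iff_trans (@compact_open_fam_compactP G R[i]^o w _ cw _) _.
split=> [/fam_cvgP Fw C cC e e0|Fw]; last first.
  apply/fam_cvgP => C cC U /uniform_nbhs[E [/=]].
  rewrite -entourage_ballE => -[e /= e0 eE] EU.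
  have := Fw C cC e e0; apply: filterS => v vw; apply: EU => x Cx.
  by apply: eE; rewrite /= /ball/= distrC; exact: vw.
apply: (Fw C cC [set f | forall x, C x -> `|f x - w x| < e]).
apply/uniform_nbhs; exists [set xy | ball xy.1 e xy.2].
split; first exact: entourage_ball (PosNum e0).
by move=> f /= wf x Cx; rewrite distrC; exact: wf.
Qed.

Lemma dual_eval_continuous x : continuous ((fun w => w x) : dual R G -> R[i]^o).
Proof.
move=> w; apply/(@cvgrPdist_lt _ _ _ _ (nbhs_filter w)) => e e0.
have /(dual_cvgP w (nbhs_filter w))/(_ _ (@compact_set1 _ x) e e0) :
  nbhs w --> w by [].
by apply: filterS => v /(_ x erefl); rewrite distrC.
Qed.

Lemma dual_hausdorff : hausdorff_space (dual R G).
Proof.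
move=> v w vw; apply: dual_eqP => x.
apply: (@norm_hausdorff R[i] R[i]^o) => A B vA wB.
by have [u [uA uB]] := vw _ _ (@dual_eval_continuous x v A vA)
  (@dual_eval_continuous x w B wB); exists ((u : dual R G) x).
Qed.

Lemma dual_shift_continuous w : continuous (fun v : dual R G => v + w).
Proof.
move=> v; apply/(dual_cvgP _ (fmap_filter _ (nbhs_filter v))) => C cC e e0.
have /(dual_cvgP v (nbhs_filter v))/(_ _ cC e e0) : nbhs v --> v by [].
apply: filterS => u uv x Cx; rewrite !dual_addE -mulrBl normrM norm_character.
by rewrite mulr1 uv.
Qed.

End dual_topology.

(* The circle has no small subgroups: as long as [u] stays within [1/2] of [1],
   [u ^+ 2 - 1 = (u - 1) * (u + 1)] is at least [3/2] times larger than [u - 1]. *)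
Lemma norm_powers_le_half (R : realType) (z : R[i]) :
  (forall n, `|z ^+ n - 1| <= 2^-1) -> z = 1.
Proof.
move=> zn.
(* The factor (3/2)^n obtained by repeated squaring is replaced by its linear minorant [1 + n / 2],
   unbounded by the archimedean property. *)
have grow n : `|z - 1| * (1 + n%:R / 2) <= `|z ^+ (2 ^ n) - 1|.
  elim: n => [|n IH]; first by rewrite mul0r addr0 mulr1 expn0 expr1.
  set u := z ^+ (2 ^ n) in IH *.
  have -> : z ^+ (2 ^ n.+1) - 1 = (u - 1) * (u + 1).
    by rewrite expnS mulnC exprM subr_sqr_1.
  have u1 : 3 / 2 <= `|u + 1|.
    have : `|2| <= `|u + 1| + `|u - 1|.
      have -> : 2 = (u + 1) - (u - 1) :> R[i] by ring.
      exact: ler_normB.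
    rewrite normr_nat -lerBlDr; apply: le_trans.
    apply: le_trans (lerB (lexx _) (zn _)).
    by rewrite le_eqVlt; apply/orP; left; apply/eqP; field.
  have g0 : 0 <= `|z - 1| * (1 + n%:R / 2) :> R[i].
    by rewrite mulr_ge0// addr_ge0// divr_ge0.
  rewrite normrM; apply: le_trans (ler_pM g0 _ IH u1) => //.
  rewrite -mulrA ler_wpM2l// -subr_ge0.
  have -> : (1 + n%:R / 2) * (3 / 2) - (1 + n.+1%:R / 2) = n%:R / 4 :> R[i].
    by rewrite -natr1; field.
  by rewrite divr_ge0//.
apply/eqP; rewrite -subr_eq0 -normr_eq0; apply/negPn/negP => r0.
have {}r0 : 0 < `|z - 1| by rewrite lt_def r0 normr_ge0.
have /complex_realP[r rE] : `|z - 1| \is Num.real by rewrite realE normr_ge0.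
move: r0; rewrite rE ltcR => r0.
have := grow (Num.bound r^-1); rewrite rE.
move=> /le_trans/(_ (zn _)).
set n := Num.bound _.
have -> : r%:C%C * (1 + n%:R / 2) = (r * (1 + n%:R / 2))%:C%C.
  by rewrite rmorphM rmorphD fmorph_div !rmorph_nat rmorph1.
have -> : 2^-1 = (2^-1)%:C%C :> R[i] by rewrite fmorphV rmorph_nat.
rewrite lecR leNgt => /negP; apply.
have : r^-1 < n%:R by rewrite archi_boundP// invr_ge0 ltW.
rewrite -(ltr_pM2l r0) mulfV ?gt_eqF// => rn.
by nra.
Qed.

(** The image filter clusters at some point of the compact segment [-1, 1]; for an ultrafilter a
    cluster point is a limit, since a preimage or its complement belongs to [F]. *)
Lemma ultra_real_cvg (R : realType) (T : Type) (F : set_system T) (f : T -> R) :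
    UltraFilter F -> (forall t, `|f t| <= 1) ->
  exists l : R, f t @[t --> F] --> l.
Proof.
move=> FU f1.
have PF : ProperFilter (f @ F) := fmap_proper_filter f (@ultra_proper _ _ FU).
have [|l [_ lF]] := @segment_compact R (-1) 1 (f @ F) PF.
  by apply: (@filterE _ F) => t; rewrite /= in_itv/= -ler_norml.
exists l => U lU; have [//|FC] := in_ultra_setVsetC (f @^-1` U) FU.
by have [x [Ux /=]] := lF (~` U) U FC lU.
Qed.

Lemma normc_ge_Im (R : realType) (x : R[i]) : `|complex.Im x|%:C%C <= `|x|.
Proof.
rewrite -normrN -ReiNIm (le_trans (normc_ge_Re _))//.
by rewrite normrM complexiE normCi mulr1.
Qed.

Lemma ultra_circle_cvg (R : realType) (T : Type) (F : set_system T)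
    (f : T -> R[i]) :
    UltraFilter F -> (forall t, `|f t| = 1) ->
  exists l : R[i], (f t : R[i]^o) @[t --> F] --> (l : R[i]^o).
Proof.
move=> FU f1; have PF : ProperFilter F := @ultra_proper _ _ FU.
have [|a fa] := @ultra_real_cvg R T F (fun t => complex.Re (f t)) FU.
  by move=> t; rewrite -lecR -[1%:C%C](f1 t) normc_ge_Re.
have [|b fb] := @ultra_real_cvg R T F (fun t => complex.Im (f t)) FU.
  by move=> t; rewrite -lecR -[1%:C%C](f1 t) normc_ge_Im.
exists (Complex a b); apply/cvgrPdist_lt => e e0.
have /complex_realP[r rE] : e \is Num.real by rewrite realE ltW.
move: e0; rewrite {}rE ltcR => r0.
have r20 : 0 < r / 2 by rewrite divr_gt0.
move/cvgrPdist_lt : fa => /(_ _ r20) fa; move/cvgrPdist_lt : fb => /(_ _ r20) fb.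
near=> t.
have -> : Complex a b - f t =
    (a - complex.Re (f t))%:C%C + 'i%C * (b - complex.Im (f t))%:C%C.
  by rewrite [LHS]complexE; case: (f t).
rewrite (le_lt_trans (ler_normD _ _))// normrM complexiE normCi mul1r !normc_def/=.
rewrite !expr0n/= !addr0 !sqrtr_sqr -rmorphD/= ltcR [r]splitr ltrD//.
  by near: t.
by near: t.
Unshelve. all: by end_near. Qed.

Lemma shift_continuous (T : topologicalZmodType) (a : T) :
  continuous (fun x => x + a).
Proof.
move=> x.
have xa : (y, a) @[y --> x] --> (x, a) by apply: cvg_pair => //; exact: cvg_cst.
exact: cvg_comp xa (@tvs.add_continuous T (x, a)).
Qed.

Section open_subgroup.
Variables (G : topologicalZmodType) (H : zmodClosed G).

Lemma coset_open x : open [set` H] -> open [set y | y - x \in H].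
Proof.
by move=> oH; have /continuousP/(_ _ oH) := @shift_continuous G (- x).
Qed.

Lemma compact_cosets (C : set G) : open [set` H] -> compact C ->
  exists D : {fset G}, C `<=` \bigcup_(x in [set` D]) [set y | y - x \in H].
Proof.
move=> oH /compact_finite_cover/(_ G setT (fun x => [set y | y - x \in H])).
case=> [x _|x _|D _ DC]; first exact: coset_open.
  by exists x => //=; rewrite subrr rpred0.
by exists D.
Qed.

End open_subgroup.

Section annihilator_topology.
Variables (R : realType) (G : topologicalZmodType) (H : zmodClosed G).

(** If [v] is uniformly within 1/2 of [w] on [H], then for [x] in [H] the values of [v] at all
    multiples of [x], that is, all powers of [v x], stay within 1/2 of 1, which forces [v x = 1]. *)
Lemma annihilator_open : compact [set` H] -> open (@annihilator R G H).
Proof.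
move=> cH; rewrite openE => w wH.
have h0 : 0 < 2^-1 :> R[i] by rewrite invr_gt0.
have /(dual_cvgP w (nbhs_filter w))/(_ _ cH _ h0) : nbhs w --> w by [].
apply: filterS => v /= vw x xH; apply: norm_powers_le_half => n.
have <- : (v : dual R G) (x *+ n) = (v : dual R G) x ^+ n.
  elim: n => [|n IH]; first by rewrite mulr0n character0.
  by rewrite mulrS characterD IH exprS.
have nH : x *+ n \in H by rewrite rpredMn.
by have := vw _ nH; rewrite (wH _ nH) => /ltW.
Qed.

Lemma annihilator_sub (w : dual R G) x y :
  annihilator H w -> y - x \in H -> w y = w x.
Proof. by move=> wH yx; rewrite -[y](subrK x) characterD wH// mul1r. Qed.

(** An ultrafilter of characters has a pointwise limit [chi]. Characters trivial on [H] are constant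
    on its open cosets; hence so is [chi], which makes it continuous, and convergence is uniform on
    a compact set because finitely many cosets cover it. *)
Lemma annihilator_compact : open [set` H] -> compact (@annihilator R G H).
Proof.
move=> oH; rewrite compact_ultra => F FU FA.
have PF := @ultra_proper _ _ FU.
have /choice[chi chiP] : forall x : G, exists l : R[i],
    ((w : dual R G) x : R[i]^o) @[w --> F] --> (l : R[i]^o).
  by move=> x; apply: ultra_circle_cvg => w; exact: norm_character.
have chi_eq x y : y - x \in H -> chi y = chi x.
  move=> yx; apply: (@norm_cvg_unique _ R[i]^o _ _ _ _ (chiP y)).
  apply: cvg_trans (chiP x); apply: near_eq_cvg.
  by apply: filterS FA => w wH; rewrite (annihilator_sub wH yx).
have chi_char : is_character chi.
  split=> [x|x y|x].
  - apply/cvgrPdist_lt => e e0; near=> y.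
    rewrite (chi_eq x) ?subrr ?normr0//.
    near: y; apply: open_nbhs_nbhs; split; first exact: coset_open oH.
    by rewrite /= subrr rpred0.
  - apply: (@norm_cvg_unique _ R[i]^o _ _ _ _ (chiP (x + y))).
    have -> : (fun w : dual R G => w (x + y)) = (fun w => w x * w y).
      by apply/funext => w; exact: characterD.
    exact: (@cvgM R[i]) (chiP x) (chiP y).
  - apply: (@norm_cvg_unique _ R[i]^o (`|(w : dual R G) x| @[w --> F]) _ _).
      exact: cvg_norm (chiP x).
    have -> : (fun w : dual R G => `|w x|) = (fun=> 1).
      by apply/funext => w; exact: norm_character.
    exact: cvg_cst.
pose w : dual R G := Sub chi (asboolT chi_char).
have wE x : w x = chi x by [].
exists w; split=> /=.
  move=> x xH; rewrite wE (chi_eq 0) ?subr0//.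
  by rewrite -wE character0.
apply/dual_cvgP => C cC e e0.
have [D CD] := compact_cosets oH cC.
have : F (\bigcap_(x in [set` D]) [set v : dual R G | `|v x - chi x| < e]).
  apply: filter_bigI => x _; have /cvgrPdist_lt/(_ _ e0) := chiP x.
  by apply: filterS => v; rewrite distrC.
move: FA; apply: filterS2 => v vH vD y /CD[x xD /= yx].
by rewrite (annihilator_sub vH yx) wE (chi_eq _ _ yx); exact: vD.
Unshelve. all: by end_near. Qed.

End annihilator_topology.

(** [U i] is the union of the basic sets with code [i]: there is at most one, and a code that is not
    taken yields the empty set. *)
Lemma second_countable_sequence (T : topologicalType) : @second_countable T ->
  exists U : nat -> set T, (forall i, open (U i)) /\
    forall x A, nbhs x A -> exists2 i, U i x & U i `<=` A.
Proof.
move=> [B /countable_injP[f f_inj] [Bo Bx]].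
have UE b : B b -> \bigcup_(c in [set c | B c /\ f c = f b]) c = b.
  move=> Bb; apply/seteqP; split=> [x [c /= [Bc fcb] cx]|x bx]; last first.
    by exists b.
  by rewrite -(f_inj _ _ (mem_set Bc) (mem_set Bb) fcb).
exists (fun i => \bigcup_(c in [set c | B c /\ f c = i]) c); split=> [i|x A xA].
  by apply: bigcup_open => c [/Bo].
have [b [Bb bx] bA] := Bx x A xA.
by exists (f b); rewrite UE.
Qed.

(** * Lindelof property of the dual of a second countable group *)

Section dual_lindelof.
Variables (R : realType) (G : preTopologicalZmodType).
Hypothesis G_second_countable : @second_countable G.

(** For [n > 0] the index [(n, a, b)] encodes the open disc of radius [2 / n] around the grid point
    [(a + i b) / n]. With [a] and [b] obtained by rounding down, each coordinate of the difference
    is below 1 after scaling by [n], so radius 2 makes the cells of given [n] cover the plane. *)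
Definition grid_cell (k : nat * int * int) : set R[i] :=
  [set z | `|z * k.1.1%:R - (k.1.2%:~R + 'i%C * k.2%:~R)| < 2].

Lemma grid_cell_cover n z : exists k, k.1.1 = n /\ grid_cell k z.
Proof.
exists (n, Num.floor (complex.Re z * n%:R), Num.floor (complex.Im z * n%:R)).
split=> //=; rewrite /grid_cell/=.
set a := Num.floor _; set b := Num.floor _.
have -> : z * n%:R - (a%:~R + 'i%C * b%:~R) =
    (complex.Re z * n%:R - a%:~R)%:C%C +
    'i%C * (complex.Im z * n%:R - b%:~R)%:C%C.
  rewrite {1}[z]complexE !rmorphB !rmorphM !rmorph_nat !rmorph_int.
  ring.
rewrite (le_lt_trans (ler_normD _ _))// normrM complexiE normCi mul1r.
rewrite !normc_def/= !expr0n/= !addr0 !sqrtr_sqr -rmorphD/=.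
have -> : 2 = 2%:C%C :> R[i] by rewrite rmorph_nat.
rewrite ltcR !ger0_norm ?subr_ge0 ?floor_le//.
have := floorD1_gt (complex.Re z * n%:R).
have := floorD1_gt (complex.Im z * n%:R).
rewrite -/a -/b !intrD; lra.
Qed.

Lemma grid_cell_open k : open (grid_cell k : set R[i]^o).
Proof.
have -> : grid_cell k = (fun z => z * k.1.1%:R - (k.1.2%:~R + 'i%C * k.2%:~R))
    @^-1` ball (0 : R[i]^o) 2.
  by apply/seteqP; split => z; rewrite /grid_cell /ball/= sub0r normrN.
apply: (@open_comp R[i]^o R[i]^o) => [z _|]; last exact: ball_open.
have zn : (y * k.1.1%:R : R[i]^o) @[y --> (z : R[i]^o)] --> z * k.1.1%:R.
  exact: mulrr_continuous.
by apply: (@cvgB R[i] R[i]^o) zn _; exact: (@cvg_cst R[i]^o).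
Qed.

Lemma grid_cell_diam k z z' : grid_cell k z -> grid_cell k z' ->
  `|z - z'| * k.1.1%:R < 4.
Proof.
rewrite /grid_cell/=; set c := (k.1.2%:~R + _) => zk z'k.
rewrite -[k.1.1%:R]normr_nat -normrM.
have -> : (z - z') * k.1.1%:R = (z * k.1.1%:R - c) - (z' * k.1.1%:R - c).
  by ring.
rewrite (le_lt_trans (ler_normB _ _))//.
have -> : 4 = 2 + 2 :> R[i] by ring.
exact: (ltrD zk z'k).
Qed.

(* The sets [M P] below, indexed by finite lists of pairs (basic open set of [G],
   grid cell), are not open, but they form a countable network, which is enough
   for the Lindelof property. *)
Lemma dual_lindelof (O : set (dual R G)) (N : dual R G -> set (dual R G)) :
    (forall w, O w -> nbhs w (N w)) ->
  exists D, [/\ countable D, D `<=` O & O `<=` \bigcup_(w in D) N w].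
Proof.
move=> ON.
have [U [Uo Ux]] := second_countable_sequence G_second_countable.
pose M (P : seq (nat * (nat * int * int))) : set (dual R G) :=
  [set w | forall q, q \in P -> forall x, U q.1 x -> grid_cell q.2 (w x)].
have MN w : O w -> exists P, M P w /\ M P `<=` N w.
  (* The sets [M P] containing [w] form a filter base, concatenation of lists giving intersections;
     it remains to see that this filter converges to [w]. *)
  pose F := filter_from (M^~ w) M.
  have FF : Filter F.
    apply: filter_from_filter; first by exists [::].
    move=> P Q Pw Qw; exists (P ++ Q).
      by move=> q; rewrite mem_cat => /orP[/Pw|/Qw].
    by move=> v vPQ; split=> q qP; apply: vPQ; rewrite mem_cat qP ?orbT.
  move=> Ow; suff Fw : F --> w by have [P] := Fw _ (ON w Ow); exists P.
  apply/dual_cvgP => C cC e e0.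
  (* Cells with denominator [n] have diameter at most [4 / n]. The list to be built pairs finitely
     many basic sets covering [C] with cells into which [w] maps them. *)
  have [n n0 ne] : exists2 n : nat, (0 < n)%N & 4 / n%:R < e.
    have /complex_realP[r rE] : e \is Num.real by rewrite realE ltW.
    move: e0; rewrite {}rE ltcR => r0.
    exists (Num.bound (4 / r)).+1 => //.
    have -> : 4 / (Num.bound (4 / r)).+1%:R =
       (4 / (Num.bound (4 / r)).+1%:R)%:C%C :> R[i].
      by rewrite fmorph_div !rmorph_nat.
    rewrite ltcR ltr_pdivrMr// mulrC -ltr_pdivrMr//.
    have r40 : 0 <= 4 / r by rewrite divr_ge0// ltW.
    by apply: lt_le_trans (archi_boundP r40) _; rewrite ler_nat.
  have /choice[k kP] x : exists k, k.1.1 = n /\ grid_cell k (w x).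
    exact: grid_cell_cover.
  have /choice[i iP] x : exists i, U i x /\ U i `<=` w @^-1` grid_cell (k x).
    have [|i Ui UV] := Ux x (w @^-1` grid_cell (k x)); last by exists i.
    apply: (@character_continuous R G w); apply: open_nbhs_nbhs.
    by split; [exact: grid_cell_open|exact: (kP x).2].
  have [x _|x _|D _ CD] := compact_finite_cover cC (D := setT) (f := U \o i).
    - exact: Uo.
    - by exists x => //; exact: (iP x).1.
  exists [seq (i x, k x) | x <- D].
    by move=> _ /mapP[x _ ->] y; exact: (iP x).2.
  move=> v vP y /CD[x xD Uy].
  have vk : grid_cell (k x) (v y).
    by apply: (vP (i x, k x)) => //; exact: map_f.
  have wk : grid_cell (k x) (w y) := (iP x).2 _ Uy.
  apply: lt_trans ne; rewrite ltr_pdivlMr ?ltr0n//.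
  by rewrite -(kP x).1; exact: grid_cell_diam.
(* One character is chosen for each list, and lists are countable. The value [0] is a dummy for
   lists without a suitable character; these are discarded in the definition of [D]. *)
have /choice[g gP] P : exists w, forall v, O v -> M P v /\ M P `<=` N v ->
    O w /\ M P `<=` N w.
  have [[w wP]|nw] := pselect (exists w, O w /\ M P `<=` N w).
    by exists w.
  by exists 0 => v Ov [_ PN]; exfalso; apply: nw; exists v.
exists (g @` [set P | O (g P) /\ M P `<=` N (g P)]); split.
- exact: card_le_trans (card_image_le _ _) (countableP _).
- by move=> _ [P [Og _] <-].
move=> w Ow; have [P MP] := MN w Ow; have [Og PN] := gP P w Ow MP.
by exists (g P); [exists P|exact: PN MP.1].
Qed.

End dual_lindelof.

(** * Weil's formula and indices *)

Section borel.

Lemma borel_open (T : preTopologicalZmodType) (U : set T) :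
  open U -> measurable (U : set (borel T)).
Proof. by move=> oU; exact: sub_sigma_algebra. Qed.

Lemma borel_closed (T : preTopologicalZmodType) (U : set T) :
  closed U -> measurable (U : set (borel T)).
Proof.
move=> cU; rewrite -[U]setCK; apply: measurableC.
by apply: borel_open; exact: closed_openC.
Qed.

Lemma borel_continuous (T T' : preTopologicalZmodType) (f : T -> T') :
  continuous f -> measurable_fun [set: borel T] (f : borel T -> borel T').
Proof.
move=> /continuousP cf; apply: (@measurability _ _ (borel T) (borel T') setT f (@open T')) => //.
by move=> _ [U oU <-]; rewrite setTI; apply: borel_open; exact: cf.
Qed.

End borel.

Section coset_map.
Variables (G : preTopologicalZmodType) (S : zmodClosed G).

Definition coset_map (x : G) : quotient S := (\pi_(Quotient.quot S) x)%qT.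

Lemma coset_map_repr (q : quotient S) : coset_map (repr q) = q.
Proof. exact: reprK. Qed.

Lemma coset_mapP x y : coset_map x = coset_map y <-> x - y \in S.
Proof.
rewrite Quotient.idealrBE; split=> [xy|/eqP xy]; last exact: xy.
by apply/eqP; exact: xy.
Qed.

Lemma coset_map_open (U : set (quotient S)) : open (coset_map @^-1` U) -> open U.
Proof. by []. Qed.

End coset_map.

Section weil_coset.
Variables (R : realType) (L N : preTopologicalZmodType) (S : zmodClosed L).
Variables (i : N -> L) (muL : {measure set (borel L) -> \bar R}).
Variables (muN : {measure set (borel N) -> \bar R}).
Variables (muQ : {measure set (borel (quotient S)) -> \bar R}).
Local Open Scope ereal_scope.

(** Weil's formula for the indicator of [x + A]: a class that meets [x + A] does so, in the
    coordinate [n], along a translate of the preimage of [A] under [i], so the inner integral takes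
    a single nonzero value. The map [i] and the subgroup [A] are kept general to cover the quotients
    of G by K, of G by H + K, and of H + K by K. *)
Lemma weil_coset (A : {pred L}) (x : L) :
    weil i muL muN muQ -> is_haar muN -> zmod_closed A ->
    {morph i : n m / (n + m)%R >-> (n + m)%R} ->
    (forall s, s \in S <-> exists n, s = i n) ->
    measurable ([set y | (y - x)%R \in A] : set (borel L)) ->
    measurable ([set coset_map S y | y in [set y | (y - x)%R \in A]] :
      set (borel (quotient S))) ->
    (forall y, measurable ([set n | (y + i n)%R \in A] : set (borel N))) ->
  muL [set y | (y - x)%R \in A] =
  muN [set n | i n \in A] *
  muQ [set coset_map S y | y in [set y | (y - x)%R \in A]].
Proof.
move=> W [muN_inv _ _] [A0 AB] iD iS mC mB mN.
set C := [set y | _]; set B := [set coset_map S y | y in C].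
have AN y : y \in A -> (- y)%R \in A by move=> yA; rewrite -sub0r AB.
have AD y z : y \in A -> z \in A -> (y + z)%R \in A.
  by move=> yA zA; rewrite -[z]opprK AB// AN.
have mI : measurable ([set n | i n \in A] : set (borel N)).
  by have := mN 0%R; congr measurable; apply/seteqP; split=> n /=; rewrite add0r.
have := W (fun y => (\1_C y)%:E); rewrite integral_indic// setIT => ->; last 2 first.
- by apply/measurable_EFinP; exact: measurable_indic.
- by move=> y; rewrite lee_fin.
transitivity (\int[muQ]_q (muN [set n | i n \in A] * (\1_B q)%:E)); last first.
  by rewrite ge0_integralZl// ?integral_indic ?setIT//; apply/measurable_EFinP; exact: measurable_indic.
apply: eq_integral => q _.
have -> : (fun n => (\1_C (repr (q : quotient S) + i n)%R)%:E) =
    (fun n => (\1_[set n | (repr q + i n - x)%R \in A] n)%:E :> \bar R).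
  by apply/funext => n; rewrite !indicE; congr (_%:R%:E); apply/idP/idP; rewrite !inE.
have mCq : measurable ([set n | (repr q + i n - x)%R \in A] : set (borel N)).
  have := mN (repr q - x)%R; congr measurable.
  by apply/seteqP; split => n /=; rewrite addrAC.
rewrite integral_indic// setIT indicE.
have [|qB] := boolP (q \in B); rewrite ?mule1 ?mule0.
  move=> /set_mem[y /= yC yq].
  have /iS[m ym] : (repr q - y)%R \in S by apply/coset_mapP; rewrite coset_map_repr.
  transitivity (muN [set n | [set n | i n \in A] (m + n)%R]); last exact: muN_inv.
  congr (muN _); apply/seteqP; split=> n /=; rewrite iD -ym.
    move=> h; have := AB _ _ h yC; congr (_ \in A).
    by rewrite opprB addrA subrK addrAC.
  move=> h; have := AD _ _ h yC; congr (_ \in A).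
  by rewrite addrA [X in (X - _)%R]addrAC subrK addrAC.
rewrite (_ : [set n | _] = set0) ?measure0//.
apply/seteqP; split=> n //= h; move/negP: qB; apply; apply/mem_set.
exists (repr q + i n)%R => //; rewrite -[RHS]coset_map_repr.
by apply/coset_mapP; rewrite addrAC subrr add0r; apply/iS; exists n.
Qed.

End weil_coset.

Lemma counting_set1 (R : realType) (T : choiceType) (x : T) :
  counting [set x] = 1%E :> \bar R.
Proof. by rewrite /counting asboolT// fset_set1 cardfs1. Qed.

Lemma sume_const (R : realType) (I : Type) (s : seq I) (c : \bar R) :
  (0 <= c -> \sum_(i <- s) c = (size s)%:R%:E * c)%E.
Proof.
move=> c0; elim: s => [|i s IH]; first by rewrite big_nil mul0e.
by rewrite big_cons IH -natr1 EFinD ge0_muleDl ?lee_fin// mul1e addeC.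
Qed.

(** * Index of H + K and comparison of covolumes *)

Section index.
Variables (R : realType) (G : topologicalZmodType) (H K : zmodClosed G).
Hypothesis H_open : open [set` H].

Local Notation HK := (subgroup_sum H K).

Lemma subgroup_sumP x : x \in HK <-> exists h k, [/\ h \in H, k \in K & x = h + k].
Proof.
split; first by move=> /set_mem[h hH [k kK <-]]; exists h, k.
by move=> [h [k [hH kK ->]]]; apply/mem_set; exists h => //; exists k.
Qed.

Lemma sub_subgroup_suml h : h \in H -> h \in HK.
Proof.
by move=> hH; apply/subgroup_sumP; exists h, 0; rewrite addr0 rpred0.
Qed.

Lemma subgroup_sum_open : open [set` HK].
Proof.
have -> : [set` HK] = \bigcup_(k in [set` K]) [set x | x - k \in H].
  apply/seteqP; split=> x /=.
    by move=> /subgroup_sumP[h [k [hH kK ->]]]; exists k => //=; rewrite addrK.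
  move=> [k /= kK xk]; apply/subgroup_sumP.
  by exists (x - k), k; rewrite subrK.
by apply: bigcup_open => k _; exact: coset_open.
Qed.

Lemma quotient_discrete (V : set (quotient HK)) : open V.
Proof.
apply: coset_map_open.
have -> : coset_map HK @^-1` V =
    \bigcup_(x in coset_map HK @^-1` V) [set y | y - x \in HK].
  apply/seteqP; split=> y /=; first by exists y => //=; rewrite subrr rpred0.
  by move=> [x /= xV /coset_mapP ->].
by apply: bigcup_open => x _; apply: coset_open; exact: subgroup_sum_open.
Qed.

(** The blocks are the fibres of the projection of G / K onto G / (H + K). *)
Definition block (x : G) : set (quotient K) :=
  [set coset_map K y | y in [set y | y - x \in H]].

Lemma block_open x : open (block x).
Proof.
apply: coset_map_open.
have -> : coset_map K @^-1` block x =
    \bigcup_(k in [set` K]) [set y | y - (x + k) \in H].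
  apply/seteqP; split=> y /=.
    move=> [z /= zx /coset_mapP zy]; exists (y - z) => /=.
      by rewrite -opprB rpredN.
    by rewrite opprD opprB addrCA [y + _]addrC subrK addrC.
  move=> [k /= kK yxk]; exists (y - k) => /=; first by rewrite -addrA -opprD (addrC k).
  by apply/coset_mapP; rewrite addrAC subrr sub0r rpredN.
by apply: bigcup_open => k _; exact: coset_open.
Qed.

Lemma block_meet x y : block x `&` block y !=set0 -> coset_map HK x = coset_map HK y.
Proof.
move=> [_ [[u /= ux <-] [v /= vy /coset_mapP vu]]]; apply/coset_mapP.
apply/subgroup_sumP; exists (x - y - (u - v)), (u - v); rewrite subrK.
split => //; last by rewrite -opprB rpredN.
by rewrite opprB addrACA (addrC x) -addrACA -[x - u]opprB rpredB.
Qed.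

Lemma mem_block y x : y - x \in HK -> block x (coset_map K y).
Proof.
move=> /subgroup_sumP[h [k [hH kK yx]]]; exists (x + h) => /=.
  by rewrite addrAC subrr add0r.
apply/coset_mapP; have -> : x + h - y = - k; last by rewrite rpredN.
by rewrite -(subrK x y) yx [_ + x]addrC addrA opprD addrA subrr sub0r.
Qed.

Lemma block_cover : \bigcup_(q in [set: quotient HK]) block (repr q) = setT.
Proof.
apply/seteqP; split=> // p _; exists (coset_map HK (repr p)) => //.
rewrite -[p in block _ p]coset_map_repr; apply: mem_block.
by apply/coset_mapP; rewrite coset_map_repr.
Qed.

(** Finitely many of the open blocks cover the compact quotient, and blocks that meet belong to the
    same class modulo [HK]. *)
Lemma finite_index : compact [set: quotient K] -> finite_set [set: quotient HK].
Proof.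
move=> /compact_finite_cover/(_ G setT block)[x _|p _|D _ DT].
- exact: block_open.
- have [q _ qp] : (\bigcup_(q in [set: quotient HK]) block (repr q)) p.
    by rewrite block_cover.
  by exists (repr q).
have -> : [set: quotient HK] = coset_map HK @` [set` D].
  apply/seteqP; split=> // q _.
  have [x xD xq] := DT (coset_map K (repr q)) I.
  exists x => //; rewrite -[RHS]coset_map_repr; apply: block_meet.
  exists (coset_map K (repr q)); split=> //; exists (repr q) => //=.
  by rewrite subrr rpred0.
exact/finite_image/finite_fset.
Qed.

Section covolume.
Variables (mu : {measure set (borel G) -> \bar R}).
Variables (muK : {measure set (borel (subgroup K)) -> \bar R}).
Variables (muQ : {measure set (borel (quotient K)) -> \bar R}).
Variables (muHK : {measure set (borel (subgroup HK)) -> \bar R}).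
Variables (muHQ : {measure set (borel (quotient (sumr H K))) -> \bar R}).
Hypotheses (mu_haar : is_haar mu) (mu_H : mu [set` H] = 1%E).
Hypotheses (muK_haar : is_haar muK) (muHK_haar : is_haar muHK).
Hypothesis muQ_weil : weil (\val : subgroup K -> G) mu muK muQ.
Hypothesis muHK_weil : weil (S := HK) (\val : subgroup HK -> G) mu muHK counting.
Hypothesis muHQ_weil : weil (@subgroup_sumr G H K) muHK muK muHQ.
Local Open Scope ereal_scope.

Let coset_measurable x : measurable ([set y | (y - x)%R \in H] : set (borel G)).
Proof. by apply: borel_open; exact: coset_open. Qed.

Lemma haar_coset x : mu [set y | (y - x)%R \in H] = 1.
Proof.
have [mu_inv _ _] := mu_haar.
rewrite -mu_H -[RHS](mu_inv (- x)%R); last exact: borel_open.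
by congr (mu _); apply/seteqP; split => y /=; rewrite addrC.
Qed.

Lemma val_open (S : zmodClosed G) (U : set G) : open U ->
  open (\val @^-1` U : set (subgroup S)).
Proof. by move=> oU; exists U. Qed.

Let mI y (S : zmodClosed G) :
  measurable ([set n | (y + \val n)%R \in H] : set (borel (subgroup S))).
Proof.
apply: borel_open; apply: (@val_open S [set z | (y + z)%R \in H]).
have -> : [set z | (y + z)%R \in H] = [set z | (z - (- y))%R \in H].
  by apply/seteqP; split => z /=; rewrite opprK addrC.
exact: coset_open.
Qed.

(* Together with [weil_quotient] this shows that every block and the whole of
   [HK / K] have the same measure, the inverse of that of [K `&` H]. *)
Lemma weil_block x : muK [set n | \val n \in H] * muQ (block x) = 1.
Proof.
rewrite -(haar_coset x); apply/esym.
apply: (weil_coset muQ_weil muK_haar) => //.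
- by split; [exact: rpred0|exact: rpredB].
- move=> s; split=> [sK|[n ->]]; last exact: valP.
  by exists (Sub s sK); rewrite SubK.
- by apply: borel_open; exact: block_open.
- by move=> y; exact: mI.
Qed.

(** The image of [H] in G / (H + K) is a single point, of counting measure 1, so [muHK] and [mu]
    give [H] the same mass. *)
Lemma weil_sum : muHK [set n | \val n \in H] = 1.
Proof.
have E : [set coset_map HK y | y in [set y | (y - 0)%R \in H]] =
    [set coset_map HK 0%R].
  apply/seteqP; split=> [_ [y /= yH <-]|_ ->].
    by apply/coset_mapP; exact: sub_subgroup_suml.
  by exists 0%R => //=; rewrite subr0 rpred0.
have W := @weil_coset R G (subgroup HK) HK \val mu muHK counting (mem H) 0%R.
rewrite -(haar_coset 0) W ?E//.
- transitivity (muHK [set n | \val n \in H] * 1); first by rewrite mule1.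
  congr (_ * _); exact/esym/counting_set1.
- by split; [exact: rpred0|exact: rpredB].
- move=> s; split=> [sK|[n ->]]; last exact: valP.
  by exists (Sub s sK); rewrite SubK.
- by apply: borel_open; exact: quotient_discrete.
Qed.

Lemma weil_quotient : muK [set n | \val n \in H] * muHQ setT = 1.
Proof.
pose A : {pred subgroup HK} := [pred y | \val y \in H].
(* Modulo [K], every element of [HK] agrees with an element of [H]. *)
have E : [set coset_map (sumr H K) y | y in [set y | (y - 0)%R \in A]] = setT.
  apply/seteqP; split=> // q _.
  have /subgroup_sumP[h [k [hH kK hk]]] := valP (repr q).
  exists (Sub h (sub_subgroup_suml hH)).
    by rewrite /= subr0 inE SubK.
  rewrite -[RHS]coset_map_repr; apply/coset_mapP.
  by rewrite inE raddfB/= hk opprD addrA subrr sub0r rpredN.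
have W := @weil_coset R (subgroup HK) (subgroup K) (sumr H K)
  (@subgroup_sumr G H K) muHK muK muHQ A 0%R muHQ_weil muK_haar.
rewrite -weil_sum -E -W//.
- by congr (muHK _); apply/seteqP; split => y /=; rewrite subr0.
- by split=> [|x y]; rewrite !inE ?raddf0 ?rpred0// raddfB; exact: rpredB.
- by move=> n m; exact: val_inj.
- move=> s; split=> [|[n ->]]; last by rewrite inE SubK; exact: valP.
  by rewrite inE => sK; exists (Sub (\val s) sK); apply/val_inj; rewrite !SubK.
- apply: borel_open; rewrite (_ : [set y | _] = \val @^-1` [set` H]).
    exact: val_open.
  by apply/seteqP; split => y /=; rewrite subr0.
- by rewrite E.
- move=> y; exact: @mI (\val y) K.
Qed.

(** Both sides are inverse to the mass of [H] in [K]; inserting a product equal to 1 avoids a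
    division in [\bar R]. *)
Lemma muQ_block x : muQ (block x) = muHQ setT.
Proof.
rewrite -[LHS]mule1 -weil_quotient muleA [X in X * _]muleC weil_block.
by rewrite mul1e.
Qed.

Lemma covolume_sum n : ([set: quotient HK] #= `I_n)%card ->
  covolume muQ = n%:R%:E * covolume muHQ.
Proof.
move=> cn; have fT : finite_set [set: quotient HK] by apply/finite_setP; exists n.
rewrite /covolume -[X in muQ X]block_cover measure_fin_bigcup//.
- rewrite fsbig_finite//=; under eq_bigr do rewrite muQ_block.
  by rewrite sume_const// (card_fset_set cn).
- by move=> p q _ _ /block_meet; rewrite !coset_map_repr.
- by move=> q _; apply: borel_open; exact: block_open.
Qed.

End covolume.
End index.

(** * Annihilator of an open subgroup of finite index *)

Lemma card_set_uniq (T : choiceType) (s : seq T) : uniq s ->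
  ([set` s] #= `I_(size s))%card.
Proof.
move=> us; have -> : [set` s] = [set` [fset x in s]%fset].
  by apply/seteqP; split => x /=; rewrite in_fset.
by apply/card_eq_fsetP; rewrite card_fseq undup_id.
Qed.

Lemma card_characters (Q : zmodType) (F : closedFieldType) :
    [pchar F]%R =i pred0 -> finite_set [set: Q] ->
  ([set chi : Q -> F | chi 0 = 1 /\ {morph chi : x y / x + y >-> x * y}]
    #= [set: Q])%card.
Proof.
move=> F0 /finite_seqP[s sT].
have mem_s x : x \in undup s.
  by rewrite mem_undup; have : [set: Q] x by []; rewrite sT.
have idxK : pcancel (index^~ (undup s)) (fun i => Some (nth 0 (undup s) i)).
  by move=> x; rewrite nth_index.
have enumP : Finite.axiom (undup s).
  by move=> x; rewrite count_uniq_mem ?undup_uniq// mem_s.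
pose cQ : countType := HB.pack Q (PCanIsCountable idxK).
pose U : finZmodType := HB.pack Q (PCanIsCountable idxK) (fintype.isFinite.Build cQ enumP).
have [c [c_uniq c_size cP]] := finite_characters U F0.
(* [Q] and [U] share their carrier. *)
have -> : [set chi : Q -> F | chi 0 = 1 /\ {morph chi : x y / x + y >-> x * y}] =
    (fun chi : {ffun U -> F} => chi : Q -> F) @` [set` c].
  apply/seteqP; split=> [chi [chi0 chiD]|_ [chi /= /cP[chi0 chiD] <-//]].
  exists [ffun x : U => chi x]; last by apply/funext => x; rewrite ffunE.
  by apply/cP; split=> [|x y]; rewrite !ffunE.
have -> : [set: Q] = [set` undup s].
  by apply/seteqP; split=> x _; rewrite /= ?mem_s.
have sizeU : #|U| = size (undup s) by rewrite cardE enumT unlock.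
have := card_set_uniq (undup_uniq s); rewrite -sizeU -c_size => /card_esym.
apply: card_eq_trans; apply: card_eq_trans (card_set_uniq c_uniq).
apply: inj_card_eq => f g _ _ fg; apply/ffunP => x.
by rewrite [f x](congr1 (fun h : Q -> F => h x) fg).
Qed.

(** By the pigeonhole principle two multiples of [q] coincide, so the modulus of [chi q] is a
    positive root of unity. *)
Lemma norm_finite_character (R : realType) (Q : zmodType) (chi : Q -> R[i]) q :
    finite_set [set: Q] -> chi 0 = 1 -> {morph chi : x y / x + y >-> x * y} ->
  `|chi q| = 1.
Proof.
move=> fQ chi0 chiD.
have chiX n : chi (q *+ n) = chi q ^+ n.
  by elim: n => [|n IH]; rewrite ?mulr0n// mulrS chiD IH exprS.
have [m [n [mn qmn]]] : exists m n, (m < n)%N /\ q *+ m = q *+ n.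
  apply: contrapT => nq; apply: infinite_nat.
  apply: (@finite_preimage _ _ [set: Q] (fun n => q *+ n)) fQ => m n _ _ qmn.
  have [mn|nm|//] := ltngtP m n; exfalso; apply: nq.
    by exists m, n.
  by exists n, m.
have chiN0 : `|chi q| ^+ m != 0.
  rewrite expf_neq0// normr_eq0; apply/eqP => chiq0.
  have := chiD q (- q); rewrite subrr chi0 chiq0 mul0r => /eqP.
  by rewrite oner_eq0.
apply/eqP; rewrite -(@pexpr_eq1 _ _ (n - m))// ?subn_gt0//.
apply/eqP/(mulfI chiN0); rewrite -exprD subnKC ?(ltnW mn)// mulr1.
by rewrite -!normrX -!chiX qmn.
Qed.

Section annihilator_card.
Variables (R : realType) (G : topologicalZmodType) (S : zmodClosed G).
Hypotheses (S_open : open [set` S]) (S_fin : finite_set [set: quotient S]).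

Lemma coset_mapD x y : coset_map S (x + y) = coset_map S x + coset_map S y.
Proof. exact: (@Quotient.pi_add _ S). Qed.

Lemma coset_map0 : coset_map S 0 = 0.
Proof. by apply: (addrI (coset_map S 0)); rewrite -coset_mapD !addr0. Qed.

(** Characters trivial on [S] correspond to the multiplicative maps on G / S: openness of [S] makes
    every lift continuous, and finiteness of the quotient makes its values unimodular. *)
Lemma card_annihilator : (@annihilator R G S #= [set: quotient S])%card.
Proof.
pose chars := [set chi : quotient S -> R[i] |
  chi 0 = 1 /\ {morph chi : x y / x + y >-> x * y}].
have cardC : (chars #= [set: quotient S])%card.
  by apply: card_characters => //; exact: Num.Theory.pchar_num.
apply: card_eq_trans cardC.
pose phi (w : dual R G) : quotient S -> R[i] := fun q => w (repr q).
have phiE w x : annihilator S w -> phi w (coset_map S x) = w x.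
  move=> wS; apply: (annihilator_sub wS).
  by apply/coset_mapP; rewrite coset_map_repr.
have <- : phi @` annihilator S = chars.
  apply/seteqP; split=> [_ [w wS <-]|chi [chi0 chiD]].
    split; first by rewrite -coset_map0 phiE// character0.
    move=> p q; rewrite -(coset_map_repr p) -(coset_map_repr q) -coset_mapD.
    by rewrite !phiE// characterD.
  have chi_char : is_character (chi \o coset_map S).
    split=> [x|x y|x] /=.
    - apply/(@cvgrPdist_lt _ R[i]^o) => e e0; near=> y.
      suff yx : coset_map S y = coset_map S x by rewrite /= yx subrr normr0.
      apply/coset_mapP; near: y; apply: open_nbhs_nbhs; split.
        exact: coset_open.
      by rewrite /= subrr rpred0.
    - by rewrite coset_mapD chiD.
    - exact: norm_finite_character.
  exists (Sub (chi \o coset_map S) (asboolT chi_char)).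
    move=> x xS; rewrite -[RHS]chi0 -coset_map0; congr chi.
    by apply/coset_mapP; rewrite subr0.
  by apply/funext => q; rewrite -[in RHS](coset_map_repr q).
apply: card_esym; apply: inj_card_eq => v w /set_mem vS /set_mem wS vw.
by apply: dual_eqP => x; rewrite -!phiE// vw.
Unshelve. all: by end_near. Qed.

End annihilator_card.

(** * Sums and integrals *)

Open Scope ereal_scope.

(** Gives access to the theorems on series; integers that encode no element of [J] contribute 0. *)
Lemma esum_countType (R : realType) (J : countType) (a : J -> \bar R) :
    (forall j, 0 <= a j) ->
  \esum_(j in [set: J]) a j = \sum_(n <oo) oapp a 0 (pickle_inv n).
Proof.
move=> a0; have b0 n : 0 <= oapp a 0 (pickle_inv n) by case: pickle_inv => /=.
rewrite nneseries_esumT//.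
transitivity (\esum_(n in range (@choice.pickle J)) oapp a 0 (pickle_inv n)).
  rewrite (@reindex_esum _ _ _ setT (range (@choice.pickle J)) (@choice.pickle J)).
    by apply: eq_esum => j _; rewrite pickleK_inv.
  by split=> // i j _ _ /(pcan_inj pickleK).
rewrite esum_mkcond; apply: eq_esum => n _.
case: ifPn => // /negP nJ; case E : (pickle_inv n) => [j|]//=.
exfalso; apply: nJ; apply/mem_set; exists j => //.
by have := @choice.pickle_invK J n; rewrite E.
Qed.

Section integral_esum.
Context d (T : measurableType d) (R : realType) (J : countType).
Variables (mu : {measure set T -> \bar R}) (D : set T) (mD : measurable D).
Variable f : J -> T -> \bar R.
Hypothesis mf : forall j, measurable_fun D (f j).
Hypothesis f0 : forall j x, 0 <= f j x.

Lemma esum_fun_countType :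
  (fun x => \esum_(j in [set: J]) f j x) =
  (fun x => \sum_(n <oo) oapp f (cst 0) (pickle_inv n) x).
Proof.
apply/funext => x; rewrite esum_countType//.
by apply: eq_eseriesr => n _; case: pickle_inv.
Qed.

Let mg n : measurable_fun D (oapp f (cst 0) (pickle_inv n)).
Proof. by case: pickle_inv => //=; exact: measurable_cst. Qed.

Let g0 n x : 0 <= oapp f (cst 0) (pickle_inv n) x.
Proof. by case: pickle_inv => //=. Qed.

Lemma measurable_esum : measurable_fun D (fun x => \esum_(j in [set: J]) f j x).
Proof. by rewrite esum_fun_countType; exact: ge0_emeasurable_sum. Qed.

Lemma integral_esum :
  \int[mu]_(x in D) (\esum_(j in [set: J]) f j x) =
  \esum_(j in [set: J]) \int[mu]_(x in D) f j x.
Proof.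
under eq_integral do rewrite esum_countType//.
rewrite esum_countType => [|j]; last exact: integral_ge0.
transitivity (\sum_(n <oo) \int[mu]_(x in D) oapp f (cst 0) (pickle_inv n) x).
  rewrite -integral_nneseries//; apply: eq_integral => x _.
  by apply: eq_eseriesr => n _; case: pickle_inv.
by apply: eq_eseriesr => n _; case: pickle_inv => //=; rewrite integral0.
Qed.

End integral_esum.

Section tonelli_restricted.
Context d1 d2 (P : measurableType d1) (T : measurableType d2) (R : realType).
Variables (m : {sigma_finite_measure set P -> \bar R}).
Variables (mu : {measure set T -> \bar R}) (D : set T) (mD : measurable D).
Hypothesis D_fin : mu D < +oo.
Variable f : P * T -> \bar R.
Hypothesis mf : measurable_fun [set: P * T] f.
Hypothesis f0 : forall z, 0 <= f z.

Let g z := f z * (\1_D z.2)%:E.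

Let mg : measurable_fun [set: P * T] g.
Proof.
apply: emeasurable_funM => //; apply/measurable_EFinP.
by apply: measurableT_comp => //; exact: measurable_indic.
Qed.

Let g0 z : 0 <= g z.
Proof. by rewrite mule_ge0// lee_fin. Qed.

(** Tonelli's theorem asks for sigma-finite factors: [mu] is arbitrary, but its restriction to [D]
    is finite. *)
Let nu : {sigma_finite_measure set T -> \bar R} := mfrestr mD D_fin.

Let gE p : \int[nu]_y g (p, y) = \int[mu]_(y in D) f (p, y).
Proof.
transitivity (\int[nu]_(y in D) f (p, y)).
  rewrite [RHS]integral_mkcond; apply: eq_integral => y _.
  by rewrite /g patchE indicE/=; case: ifPn => _; rewrite ?mule1 ?mule0.
by apply: eq_measure_integral => A mA AD; rewrite /nu /= /mfrestr /mrestr setIidl.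
Qed.

Lemma measurable_integral_restricted :
  measurable_fun [set: P] (fun p => \int[mu]_(y in D) f (p, y)).
Proof.
have := @measurable_fun_fubini_tonelli_F _ _ _ _ _ nu g mg g0.
by congr measurable_fun; apply/funext => p; exact: gE.
Qed.

Lemma tonelli_restricted :
  \int[m]_p \int[mu]_(y in D) f (p, y) = \int[mu]_(y in D) \int[m]_p f (p, y).
Proof.
transitivity (\int[m]_p \int[nu]_y g (p, y)).
  by apply: eq_integral => p _; rewrite gE.
rewrite (@fubini_tonelli _ _ _ _ _ m nu g mg g0).
transitivity (\int[nu]_(y in D) \int[m]_p f (p, y)).
  rewrite [RHS]integral_mkcond; apply: eq_integral => y _.
  rewrite patchE; case: ifPn => yD.
    by apply: eq_integral => p _; rewrite /g /= indicE yD mule1.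
  by apply: integral0_eq => p _; rewrite /g /= indicE (negbTE yD) mule0.
by apply: eq_measure_integral => A mA AD; rewrite /nu /= /mfrestr /mrestr setIidl.
Qed.

End tonelli_restricted.

(* Unlike [ge0_le_integral] this does not require [f] to be measurable: the sum
   over an annihilator is not known to depend measurably on the parameter. *)
Lemma ge0_le_integral_nomeas d (T : measurableType d) (R : realType)
    (mu : {measure set T -> \bar R}) (f g : T -> \bar R) :
    (forall x, 0 <= f x) -> (forall x, f x <= g x) ->
  \int[mu]_x f x <= \int[mu]_x g x.
Proof.
move=> f0 fg; have g0 x : 0 <= g x by exact: le_trans (fg x).
rewrite !ge0_integralTE//; apply: le_ereal_sup => _ [h hf <-].
by exists h => // x; exact: le_trans (hf x) _.
Qed.

Close Scope ereal_scope.

(** * Fourier transform of a character restricted to a compact open subgroup *)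

Lemma Re_continuous (R : realType) : continuous (@complex.Re R : R[i]^o -> R).
Proof.
move=> z; have zF := @nbhs_filter R[i]^o z.
apply/(@cvgrPdist_lt _ _ _ _ zF) => e e0.
have e0' : 0 < e%:C%C by rewrite ltcR.
have /(@cvgrPdist_lt _ _ _ _ zF)/(_ _ e0') : nbhs (z : R[i]^o) --> (z : R[i]^o).
  by [].
apply: filterS => x; rewrite -ltcR; apply: le_lt_trans.
by rewrite -raddfB; exact: normc_ge_Re.
Qed.

Lemma Im_continuous (R : realType) : continuous (@complex.Im R : R[i]^o -> R).
Proof.
move=> z; have zF := @nbhs_filter R[i]^o z.
apply/(@cvgrPdist_lt _ _ _ _ zF) => e e0.
have e0' : 0 < e%:C%C by rewrite ltcR.
have /(@cvgrPdist_lt _ _ _ _ zF)/(_ _ e0') : nbhs (z : R[i]^o) --> (z : R[i]^o).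
  by [].
apply: filterS => x; rewrite -ltcR; apply: le_lt_trans.
by rewrite -raddfB; exact: normc_ge_Im.
Qed.

Lemma borel_continuous_real (R : realType) (T : preTopologicalZmodType)
    (f : T -> R) : continuous f -> measurable_fun [set: borel T] (f : borel T -> R).
Proof.
move=> /continuousP cf; apply: (measurability _ (RGenOInfty.measurableE R)) => //.
move=> _ [_ [x ->] <-]; rewrite setTI.
by apply: borel_open; apply: cf; exact: interval_open.
Qed.

Lemma conjc_character (R : realType) (G : preTopologicalZmodType) (w : dual R G) x :
  conjc (w x) = (w x)^-1.
Proof. by rewrite invc_norm norm_character expr1n invr1 mul1r. Qed.

Lemma normc_eq1 (R : realType) (z : R[i]) : `|z| = 1 -> Normc.normc z = 1.
Proof. by move=> z1; apply: complexI; exact: z1. Qed.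

Section haar_shift.
Variables (R : realType) (T : topologicalZmodType).
Variable (mu : {measure set (borel T) -> \bar R}).
Hypothesis mu_haar : is_haar mu.
Local Open Scope ereal_scope.

Lemma shiftl_measurable (a : T) :
  measurable_fun [set: borel T] ((fun x => (a + x)%R) : borel T -> borel T).
Proof.
apply: (@borel_continuous T T); rewrite (_ : (fun x => _) = (fun x => (x + a)%R)).
  exact: shift_continuous.
by apply/funext => x; rewrite addrC.
Qed.

Lemma ge0_integral_shift (f : borel T -> \bar R) (a : T) :
    measurable_fun setT f -> (forall x, 0 <= f x) ->
  \int[mu]_x f (a + x : T)%R = \int[mu]_x f x.
Proof.
move=> mf f0; pose phi (x : borel T) : borel T := (a + x : T)%R.
have mphi : measurable_fun setT phi by exact: shiftl_measurable.
have [mu_inv _ _] := mu_haar.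
transitivity (\int[pushforward mu phi]_x f x).
  rewrite (ge0_integral_pushforward mphi mu measurableT mf)//.
by apply: eq_measure_integral => A mA _; exact: mu_inv.
Qed.

Lemma integral_shift (f : borel T -> \bar R) (a : T) : mu.-integrable setT f ->
  \int[mu]_x f (a + x : T)%R = \int[mu]_x f x.
Proof.
move=> /integrableP[mf foo]; pose phi (x : borel T) : borel T := (a + x : T)%R.
have mphi : measurable_fun setT phi by exact: shiftl_measurable.
have [mu_inv _ _] := mu_haar.
transitivity (\int[pushforward mu phi]_x f x).
  rewrite (integral_pushforward mphi mf)//; apply/integrableP; split.
    exact: (measurableT_comp mf mphi).
  rewrite /comp (ge0_integral_shift (f := fun x => `|f x|))//.
  exact: measurableT_comp.
by apply: eq_measure_integral => A mA _; exact: mu_inv.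
Qed.

End haar_shift.

Section coset_indicator.
Variables (R : realType) (G : topologicalZmodType) (H : zmodClosed G).
Variable mu : {measure set (borel G) -> \bar R}.
Hypotheses (H_open : open [set` H]) (mu_haar : is_haar mu).
Hypothesis mu_H : mu [set` H] = 1%E.
Implicit Types chi w : dual R G.

(* Its Fourier transform is the indicator of the coset of [chi] modulo the
   annihilator of [H]. *)
Definition restrict_character chi : borel G -> R[i] :=
  fun x => if (x : G) \in H then chi x else 0.

Let mH : measurable ([set` H] : set (borel G)).
Proof. exact: borel_open. Qed.

Lemma normc_restrict_character chi x :
  Normc.normc (restrict_character chi x) = \1_[set` H] x.
Proof.
rewrite /restrict_character indicE mem_setE; case: ifPn => // xH.
  by rewrite normc_eq1// norm_character.
exact: Normc.normc0.
Qed.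

Lemma Re_restrict_character chi x :
  complex.Re (restrict_character chi x) = \1_[set` H] x * complex.Re (chi x).
Proof.
rewrite /restrict_character indicE mem_setE; case: ifPn => // xH.
  by rewrite mul1r.
by rewrite mul0r.
Qed.

Lemma Im_restrict_character chi x :
  complex.Im (restrict_character chi x) = \1_[set` H] x * complex.Im (chi x).
Proof.
rewrite /restrict_character indicE mem_setE; case: ifPn => // xH.
  by rewrite mul1r.
by rewrite mul0r.
Qed.

Lemma cmeasurable_restrict_character chi : cmeasurable (restrict_character chi).
Proof.
split.
  under eq_fun do rewrite Re_restrict_character.
  apply: measurable_funM; first exact: measurable_indic.
  apply: (@borel_continuous_real R G) => x.
  apply: (@continuous_comp G R[i]^o R chi) (@Re_continuous R _).
  exact: character_continuous.
under eq_fun do rewrite Im_restrict_character.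
apply: measurable_funM; first exact: measurable_indic.
apply: (@borel_continuous_real R G) => x.
apply: (@continuous_comp G R[i]^o R chi) (@Im_continuous R _).
exact: character_continuous.
Qed.

Lemma integrable_restrict_character chi :
  mu.-integrable setT (EFin \o (@complex.Re R \o restrict_character chi)) /\
  mu.-integrable setT (EFin \o (@complex.Im R \o restrict_character chi)).
Proof.
have [mRe mIm] := cmeasurable_restrict_character chi.
have iH : mu.-integrable setT (fun x => (\1_[set` H] x)%:E).
  apply/integrableP; split; first exact/measurable_EFinP/measurable_indic.
  under eq_integral do rewrite gee0_abs ?lee_fin//.
  by rewrite integral_indic// setIT mu_H ltry.
split; apply: le_integrable iH => //; try exact/measurable_EFinP; move=> x _ /=.
  rewrite lee_fin Re_restrict_character normrM ler_piMr// -lecR.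
  by rewrite -[1%:C%C](norm_character chi x) normc_ge_Re.
rewrite lee_fin Im_restrict_character normrM ler_piMr// -lecR.
by rewrite -[1%:C%C](norm_character chi x) normc_ge_Im.
Qed.

Lemma cintegral_restrict_character chi :
  cintegral mu (restrict_character chi) = \1_(annihilator H) chi.
Proof.
rewrite indicE; have [/set_mem chiH|chiH] := boolP (chi \in annihilator H).
  rewrite /cintegral; apply/eqP; rewrite eq_complex; apply/andP; split; apply/eqP => /=.
    transitivity (\int[mu]_x (\1_[set` H] x)).
      apply: eq_Rintegral => x _; rewrite Re_restrict_character indicE mem_setE.
      by case: (boolP (x \in H)) => [xH|]; rewrite ?mul0r// mul1r chiH.
    by rewrite /Rintegral integral_indic// setIT mu_H.
  rewrite /Rintegral integral0_eq// => x _; rewrite Im_restrict_character indicE mem_setE.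
  by case: (boolP ((x : G) \in H)) => [xH|]; rewrite ?mul0r// mul1r chiH.
have [a [aH chia]] : exists a, a \in H /\ chi a != 1.
  apply: contrapT => na; move/negP: chiH; apply; apply/mem_set => x xH.
  by apply: contrapT => /eqP chix; apply: na; exists x.
(* Translating by [a] multiplies the integral by [chi a != 1]. *)
set I := cintegral _ _.
suff : I = chi a * I.
  move=> /eqP; rewrite -subr_eq0 -{1}[I]mul1r -mulrBl mulf_eq0 subr_eq0 eq_sym.
  by rewrite (negbTE chia) => /eqP.
have [iRe iIm] := integrable_restrict_character chi.
have shift x : restrict_character chi (a + x : G) = chi a * restrict_character chi x.
  rewrite /restrict_character rpredDl// characterD.
  by case: ifPn; rewrite ?mulr0.
set u := @complex.Re R \o _ in iRe; set v := @complex.Im R \o _ in iIm.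
(* Multiplication by [chi a] mixes real and imaginary parts, so the two real integrals are tied by a
   pair of linear equations. *)
have uE x : u (a + x : G) = complex.Re (chi a) * u x - complex.Im (chi a) * v x.
  by rewrite /u /v /= shift; case: (chi a) => ? ?; case: restrict_character.
have vE x : v (a + x : G) = complex.Re (chi a) * v x + complex.Im (chi a) * u x.
  by rewrite /u /v /= shift; case: (chi a) => ? ?; case: restrict_character.
have IE : I = Complex (\int[mu]_x u x) (\int[mu]_x v x) by [].
have int_shift f g b c : mu.-integrable setT (EFin \o f) ->
    mu.-integrable setT (EFin \o g) ->
    (forall x : G, f (a + x) = b * f x + c * g x) ->
    \int[mu]_x f x = b * (\int[mu]_x f x) + c * (\int[mu]_x g x).
  move=> intf intg fE; rewrite -!RintegralZl// -RintegralD//.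
  - rewrite /Rintegral -(integral_shift mu_haar a intf); congr fine.
    by apply: eq_integral => x _; rewrite /= fE.
  - by have := integrableZl measurableT b intf; apply: eq_integrable.
  - by have := integrableZl measurableT c intg; apply: eq_integrable.
have Iu := int_shift u v (complex.Re (chi a)) (- complex.Im (chi a)) iRe iIm.
have Iv := int_shift v u (complex.Re (chi a)) (complex.Im (chi a)) iIm iRe.
have {}Iu := Iu (fun x => etrans (uE x) (esym (congr1 _ (mulNr _ _)))).
have {}Iv := Iv vE; clear int_shift uE vE.
rewrite IE; move: Iu Iv; set U := Rintegral _ _ u; set V := Rintegral _ _ v.
move=> Iu Iv; case: (chi a) Iu Iv => b c /= Iu Iv.
by congr Complex; [rewrite {1}Iu mulNr|rewrite {1}Iv].
Qed.

End coset_indicator.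

Section cLfun_indicator.
Context d (T : measurableType d) (R : realType).
Variable mu : {measure set T -> \bar R}.
Variables (f : T -> R[i]) (A : set T).
Hypotheses (mf : cmeasurable f) (mA : measurable A).
Hypothesis fA : forall x, Normc.normc (f x) = \1_A x.
Local Open Scope ereal_scope.

Lemma cLfun_indicator (p : R) : (0 < p)%R -> mu A < +oo -> cLfun mu p%:E f.
Proof.
move=> p0 Aoo; split=> //; rewrite /cLnorm unlock /Lnorm poweR_lty//.
rewrite (_ : (fun x => _) = (fun x => (\1_A x)%:E)); last first.
  apply/funext => x; rewrite fA indicE/=; case: (x \in A).
    by rewrite normr1 powR1.
  by rewrite normr0 powR0// gt_eqF.
by rewrite integral_indic// setIT.
Qed.

Lemma cLfun_indicator_oo : cLfun mu +oo f.
Proof.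
split=> //; rewrite /cLnorm unlock /Lnorm; case: ifPn => // _.
rewrite (@le_lt_trans _ _ 1)// ?ltry//; apply/ess_supP/nearW => x /=.
rewrite fA lee_fin indicE; case: (x \in A); rewrite ?normr1 ?normr0//.
Qed.

End cLfun_indicator.

Lemma cLnorm_sub0 d (T : measurableType d) (R : realType)
    (mu : {measure set T -> \bar R}) (f : T -> R[i]) :
  cLnorm mu 2%:E (f \- f) = 0%E.
Proof.
rewrite /cLnorm -(@Lnorm0 _ T R mu 2%:E); last by rewrite eqe.
by apply: eq_Lnorm => x /=; rewrite subrr Normc.normc0.
Qed.

Section test_function.
Variables (R : realType) (G : topologicalZmodType) (H : zmodClosed G).
Variable mu : {measure set (borel G) -> \bar R}.
Variable nu : {measure set (borel (dual R G)) -> \bar R}.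
Hypotheses (H_compact : compact [set` H]) (H_open : open [set` H]).
Hypotheses (mu_haar : is_haar mu) (mu_H : mu [set` H] = 1%E).
Hypothesis nu_haar : is_haar nu.
Implicit Types v w : dual R G.

Lemma annihilator0 (S : zmodClosed G) : @annihilator R G S 0.
Proof. by []. Qed.

Lemma annihilatorN (S : zmodClosed G) w :
  annihilator S w -> annihilator S (- w).
Proof. by move=> wS x xS; rewrite dual_oppE wS// invr1. Qed.

Lemma annihilatorD (S : zmodClosed G) v w :
  annihilator S v -> annihilator S w -> annihilator S (v + w).
Proof. by move=> vS wS x xS; rewrite dual_addE vS// wS// mulr1. Qed.

Definition dual_coset (w : dual R G) : set (dual R G) :=
  [set v | annihilator H (v - w)].

Lemma dual_coset_refl w : dual_coset w w.
Proof. by rewrite /dual_coset /= subrr; exact: annihilator0. Qed.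

Lemma dual_coset_open w : open (dual_coset w).
Proof.
have /continuousP := @dual_shift_continuous R G (- w).
by move=> /(_ _ (annihilator_open R H_compact)).
Qed.

Lemma compact_dual_cosets (C : set (dual R G)) : compact C ->
  exists D : {fset dual R G}, C `<=` \bigcup_(w in [set` D]) dual_coset w.
Proof.
move=> /compact_finite_cover/(_ _ setT dual_coset)[w _|w _|D _ CD].
- exact: dual_coset_open.
- by exists w => //; exact: dual_coset_refl.
- by exists D.
Qed.

Lemma dual_coset_compact w : compact (dual_coset w).
Proof.
have -> : dual_coset w = (fun v => v + w) @` annihilator H.
  apply/seteqP; split=> [v vw|_ [v vH <-]]; last by rewrite /dual_coset /= addrK.
  by exists (v - w) => //; rewrite subrK.
apply: continuous_compact; last exact: annihilator_compact.
by apply: continuous_subspaceT => v; exact: dual_shift_continuous.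
Qed.

Lemma dual_coset_finite w : (nu (dual_coset w) < +oo)%E.
Proof. by have [_ nuK _] := nu_haar; exact/nuK/dual_coset_compact. Qed.

Lemma dual_coset_measurable w :
  measurable (dual_coset w : set (borel (dual R G))).
Proof. by apply: borel_open; exact: dual_coset_open. Qed.

Lemma dual_cosetP v w u : dual_coset w v -> dual_coset w u <-> annihilator H (u - v).
Proof.
move=> wv; split=> [wu|uv].
  have -> : u - v = (u - w) + - (v - w) by rewrite opprB addrA subrK.
  by apply: annihilatorD => //; exact: annihilatorN.
rewrite /dual_coset/=; have -> : u - w = (u - v) + (v - w) by rewrite addrA subrK.
exact: annihilatorD.
Qed.

Definition coset_indicator (w : dual R G) : borel (dual R G) -> R[i] :=
  fun v => \1_(dual_coset w) (v : dual R G).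

Lemma normc_coset_indicator w v :
  Normc.normc (coset_indicator w v) = \1_(dual_coset w) v.
Proof.
rewrite /coset_indicator !indicE; case: (_ \in _); last exact: Normc.normc0.
exact: Normc.normc1.
Qed.

Lemma cmeasurable_coset_indicator w : cmeasurable (coset_indicator w).
Proof.
have mC := dual_coset_measurable w.
split.
  rewrite (_ : (fun v => _) = (\1_(dual_coset w) : borel (dual R G) -> R)).
    exact: measurable_indic.
  by apply/funext => v; rewrite /coset_indicator !indicE; case: (_ \in _).
rewrite (_ : (fun v => _) = cst 0); first exact: measurable_cst.
by apply/funext => v; rewrite /coset_indicator !indicE; case: (_ \in _).
Qed.

(** The conjugate of [v] is its inverse, so the integrand is the restriction to [H] of the character
    [w - v], and orthogonality applies. *)
Lemma fourier_restrict_character w :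
  fourier mu (restrict_character H w) = coset_indicator w.
Proof.
apply/funext => v; rewrite /fourier.
have -> : (fun x : borel G => restrict_character H w x * conjc ((v : dual R G) x)) =
    restrict_character H (w - v).
  apply/funext => x; rewrite conjc_character /restrict_character.
  by case: ifPn => _; rewrite ?mul0r// dual_addE dual_oppE.
rewrite (cintegral_restrict_character H_open mu_haar mu_H) /coset_indicator.
rewrite !indicE; congr ((nat_of_bool _)%:R); apply/idP/idP => /set_mem h; apply/mem_set.
  by rewrite /dual_coset/= -opprB; exact: annihilatorN.
by rewrite -opprB; exact: annihilatorN.
Qed.

Lemma cLfun_restrict_character (p : R) w : 0 < p ->
  cLfun mu p%:E (restrict_character H w).
Proof.
move=> p0; apply: (cLfun_indicator (A := [set` H] : set (borel G))) => //.
- exact: cmeasurable_restrict_character.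
- exact: borel_open.
- by move=> x; exact: normc_restrict_character.
- by rewrite mu_H ltry.
Qed.

Lemma cLfun_coset_indicator (p : R) w : 0 < p ->
  cLfun nu p%:E (coset_indicator w).
Proof.
move=> p0; apply: (cLfun_indicator (A := dual_coset w : set (borel (dual R G)))) => //.
- exact: cmeasurable_coset_indicator.
- exact: dual_coset_measurable.
- by move=> x; exact: normc_coset_indicator.
- exact: dual_coset_finite.
Qed.

Lemma cLfun_coset_indicator_oo w : cLfun nu +oo (coset_indicator w).
Proof.
apply: (@cLfun_indicator_oo _ _ _ nu _ (dual_coset w : set (borel (dual R G)))).
- exact: cmeasurable_coset_indicator.
- by move=> x; exact: normc_coset_indicator.
Qed.

Lemma fourier_plancherel_coset_indicator w :
  is_fourier_plancherel mu nu (restrict_character H w) (coset_indicator w).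
Proof.
split; first exact: cLfun_coset_indicator.
(* The function already lies in L^1 and L^2, so a constant sequence approximates it. *)
exists (fun=> restrict_character H w); split.
- by move=> _; split; exact: cLfun_restrict_character.
- by rewrite cLnorm_sub0; exact: cvg_cst.
- by rewrite fourier_restrict_character cLnorm_sub0; exact: cvg_cst.
Qed.

(** The coset is open, so its nonempty intersections with open sets have positive measure; it is
    closed, since a point outside has its own coset as a disjoint neighbourhood. *)
Lemma ess_supp_coset_indicator w : ess_supp nu (coset_indicator w) = dual_coset w.
Proof.
have [_ _ nu_pos] := nu_haar.
have -> : ess_supp nu (coset_indicator w) = [set v | forall U : set (dual R G),
    open U -> U v -> (0 < nu (U `&` dual_coset w))%E].
  rewrite /ess_supp (_ : [set v | coset_indicator w v != 0] = dual_coset w)//.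
  apply/seteqP; split=> v /=; rewrite /coset_indicator indicE.
    by case: (boolP (_ \in _)) => [/set_mem//|]; rewrite eqxx.
  by move=> vw; rewrite mem_set// oner_eq0.
apply/seteqP; split=> v /= hv; last first.
  move=> U oU Uv; apply: nu_pos; last by exists v.
  by apply: openI => //; exact: dual_coset_open.
apply: contrapT => vw.
have := hv (dual_coset v) (dual_coset_open v) (dual_coset_refl v).
rewrite (_ : _ `&` _ = set0) ?measure0 ?ltxx//.
apply/seteqP; split=> // u [uv uw]; apply: vw.
apply/(dual_cosetP _ uw); rewrite -opprB; exact: annihilatorN.
Qed.

End test_function.

(** * Supports and bounds of transforms *)

Lemma negligible_countable d (T : measurableType d) (R : realType)
    (mu : {measure set T -> \bar R}) (I : Type) (D : set I) (X : I -> set T) :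
  countable D -> (forall i, D i -> mu.-negligible (X i)) ->
  mu.-negligible (\bigcup_(i in D) X i).
Proof.
move=> /countable_injP[f f_inj] X0.
have -> : \bigcup_(i in D) X i =
    \bigcup_k \bigcup_(i in [set i | D i /\ f i = k]) X i.
  apply/seteqP; split=> [x [i Di Xx]|x [k _ [i [Di _] Xx]]]; last by exists i.
  by exists (f i) => //; exists i.
apply: negligible_bigcup => k.
have [[i [Di fi]]|nk] := pselect (exists i, D i /\ f i = k).
  apply: negligibleS (X0 i Di) => x [j [Dj fj] Xx].
  by rewrite (f_inj i j (mem_set Di) (mem_set Dj) (etrans fi (esym fj))).
apply: negligibleS (negligible_set0 mu) => x [i iD _].
by apply: nk; exists i.
Qed.

Section transform_estimates.
Variables (R : realType) (G : topologicalZmodType).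
Variable nu : {measure set (borel (dual R G)) -> \bar R}.
Hypothesis nu_haar : is_haar nu.
Local Open Scope ereal_scope.

Lemma measurable_sqr_normc d (T : measurableType d) (f : T -> R[i]) :
  cmeasurable f -> measurable_fun [set: T] (fun x => ((Normc.normc (f x)) ^+ 2)%:E).
Proof.
move=> [mRe mIm]; apply/measurable_EFinP.
rewrite (_ : (fun x => _) =
    (fun x => (complex.Re (f x)) ^+ 2 + (complex.Im (f x)) ^+ 2)%R).
  by apply: measurable_funD; exact: measurable_funX.
apply/funext => x; case: (f x) => a b.
by rewrite /Normc.normc sqr_sqrtr// addr_ge0// sqr_ge0.
Qed.

Lemma dual_shift_measurable (a : dual R G) :
  measurable_fun [set: borel (dual R G)]
    ((fun w => (w : dual R G) + a)%R : borel (dual R G) -> borel (dual R G)).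
Proof.
by apply: (@borel_continuous (dual R G) (dual R G)); exact: dual_shift_continuous.
Qed.

Lemma cmeasurable_dual_shift (F : borel (dual R G) -> R[i]) (a : dual R G) :
  cmeasurable F -> cmeasurable (fun w : borel (dual R G) => F ((w : dual R G) + a)%R).
Proof.
move=> [mRe mIm]; split.
  exact: (measurableT_comp mRe (dual_shift_measurable a)).
exact: (measurableT_comp mIm (dual_shift_measurable a)).
Qed.

Lemma ae_dual_shift (P : dual R G -> Prop) (a : dual R G) :
  {ae nu, forall w, P w} -> {ae nu, forall w : borel (dual R G), P ((w : dual R G) + a)%R}.
Proof.
move=> [N [mN N0 PN]]; have [nu_inv _ _] := nu_haar.
exists [set w : borel (dual R G) | N (a + w : dual R G)%R]; split.
- have := dual_shift_measurable a measurableT mN; rewrite setTI.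
  by congr measurable; apply/seteqP; split=> w /=; rewrite addrC.
- by rewrite nu_inv.
- by move=> w /= Pw; apply: PN => /=; rewrite addrC.
Qed.

(** Each point off the support has a neighbourhood on which [F] vanishes almost everywhere. By the
    Lindelof property countably many of them cover the complement of the support, so the exceptional
    set is a countable union of null sets. *)
Lemma ae_ess_supp (F : borel (dual R G) -> R[i]) :
    @second_countable G -> cmeasurable F ->
  {ae nu, forall w : borel (dual R G), ~ ess_supp nu F w -> F w = 0%R}.
Proof.
move=> G2 [mRe mIm].
pose Z : set (borel (dual R G)) := [set v | F v != 0%R].
have mZ : measurable Z.
  rewrite (_ : Z = ~` ((fun x => complex.Re (F x)) @^-1` [set 0%R] `&`
      (fun x => complex.Im (F x)) @^-1` [set 0%R])).
    apply: measurableC; apply: measurableI; rewrite -[X in measurable X]setTI.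
      exact: mRe.
    exact: mIm.
  apply/seteqP; split=> v; rewrite /Z /= eq_complex.
    by move=> /negP h [a b]; apply: h; rewrite a b !eqxx.
  by move=> h; apply/negP => /andP[/eqP a /eqP b]; exact: h.
have /choice[N NP] (w : dual R G) : exists U, ~ ess_supp nu F w ->
    [/\ open U, U w & nu (U `&` Z) = 0].
  have [ws|ws] := pselect (ess_supp nu F w); first by exists setT.
  have /existsNP[U /not_implyP[oU /not_implyP[Uw /negP]]] := ws.
  rewrite -leNgt measure_le0 => /eqP U0.
  by exists U.
have [w wF|D [cD DF FD]] := @dual_lindelof R G G2 (~` ess_supp nu F) N.
  by have [oU Uw _] := NP w wF; exact: open_nbhs_nbhs.
suff : nu.-negligible (\bigcup_(w in D) (N w `&` Z)).
  apply: negligibleS => v /= /not_implyP[vF Fv].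
  by have [w Dw vw] := FD v vF; exists w => //; split=> //; apply/eqP.
apply: negligible_countable => // w Dw; have [oU Uw U0] := NP w (DF w Dw).
apply/negligibleP => //; apply: measurableI => //; exact: borel_open.
Qed.

End transform_estimates.

(** * Sums over the annihilator *)

Open Scope ereal_scope.

Lemma esum_const (R : realType) (T : choiceType) (S : set T) n (c : \bar R) :
  (S #= `I_n)%card -> 0 <= c -> \esum_(i in S) c = n%:R%:E * c.
Proof.
move=> Sn c0; have fS : finite_set S by apply/finite_setP; exists n.
by rewrite esum_fset// fsbig_finite//= sume_const// (card_fset_set Sn).
Qed.

Lemma esumZl (R : realType) (J : countType) (a : J -> \bar R) (x : R) :
  (forall j, 0 <= a j) -> (0 <= x)%R ->
  \esum_(j in [set: J]) (x%:E * a j) = x%:E * \esum_(j in [set: J]) a j.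
Proof.
move=> a0 x0; rewrite !esum_countType//; last by move=> j; rewrite mule_ge0.
rewrite -nneseriesZl; last by move=> n _; case: pickle_inv.
by apply: eq_eseriesr => n _; case: pickle_inv => //=; rewrite mule0.
Qed.

Lemma normcM_sqr (R : realType) (y z : R[i]) :
  ((Normc.normc (y * z)) ^+ 2 = (Normc.normc y) ^+ 2 * (Normc.normc z) ^+ 2)%R.
Proof. by rewrite Normc.normcM exprMn. Qed.

Section annihilator_coset.
Variables (R : realType) (G : topologicalZmodType) (H K : zmodClosed G).
Hypotheses (H_open : open [set` H]) (n : nat).
Hypothesis index_n : ([set: quotient (subgroup_sum H K)] #= `I_n)%card.
Implicit Types u v w : dual R G.

Lemma annihilator_subgroup_sum :
  @annihilator R G (subgroup_sum H K) = annihilator H `&` annihilator K.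
Proof.
apply/seteqP; split=> [w wHK|w [wH wK] x].
  split=> x xS; apply: wHK; first exact: sub_subgroup_suml.
  exact: sub_subgroup_sumr.
by move=> /subgroup_sumP[h [k [hH kK ->]]]; rewrite characterD wH// wK// mulr1.
Qed.

Lemma card_annihilatorI : (@annihilator R G H `&` annihilator K #= `I_n)%card.
Proof.
rewrite -annihilator_subgroup_sum; apply: card_eq_trans index_n.
apply: card_annihilator; first exact: subgroup_sum_open.
by apply/finite_setP; exists n.
Qed.

Lemma card_annihilator_coset u v : annihilator K v -> dual_coset H u v ->
  (annihilator K `&` dual_coset H u #= `I_n)%card.
Proof.
move=> vK uv; apply: card_eq_trans card_annihilatorI.
have <- : (fun w => v + w)%R @` (annihilator H `&` annihilator K) =
    annihilator K `&` dual_coset H u.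
  apply/seteqP; split=> [_ [w [wH wK] <-]|w [wK uw]].
    split; first exact: annihilatorD.
    by apply/(dual_cosetP _ uv); rewrite addrAC subrr add0r.
  exists (w - v)%R; last by rewrite addrC subrK.
  split; first exact/(dual_cosetP _ uv).
  by apply: annihilatorD => //; exact: annihilatorN.
by apply: inj_card_eq => w w' _ _ /addrI.
Qed.

(** Only an inequality, since the coset may miss the annihilator of [K]; otherwise it contains
    exactly [n] of its elements. *)
Lemma esum_annihilator_coset u (c : \bar R) : 0 <= c ->
  \esum_(a in annihilator K) (if a \in dual_coset H u then c else 0)
    <= n%:R%:E * c.
Proof.
move=> c0; rewrite -esum_mkcondr.
have [->|/set0P[v [vK uv]]] := eqVneq (annihilator K `&` dual_coset H u) set0.
  by rewrite esum_set0 mule_ge0// lee_fin.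
by rewrite (esum_const (card_annihilator_coset vK uv)).
Qed.

Lemma esum_annihilator (c : \bar R) : 0 <= c ->
  \esum_(a in annihilator K) (if a \in @annihilator R G H then c else 0)
    = n%:R%:E * c.
Proof. by move=> c0; rewrite -esum_mkcondr setIC (esum_const card_annihilatorI). Qed.

End annihilator_coset.

Section upper_bound.
Variables (R : realType) (G : topologicalZmodType) (H K : zmodClosed G).
Hypotheses (H_open : open [set` H]) (n : nat).
Hypothesis index_n : ([set: quotient (subgroup_sum H K)] #= `I_n)%card.
Variable nu : {measure set (borel (dual R G)) -> \bar R}.
Hypothesis nu_haar : is_haar nu.
Variables (F g : borel (dual R G) -> R[i]) (C : set (dual R G)) (b : R).
Hypotheses (mF : cmeasurable F) (mg : cmeasurable g) (b0 : (0 <= b)%R).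
Hypothesis mC : measurable (C : set (borel (dual R G))).
Hypothesis Fb : {ae nu, forall w : borel (dual R G),
  ((Normc.normc (F w)) ^+ 2 <= b * \1_C w)%R}.

(** The bound on [F], translated by [a], kills the integrand unless [w + a] lies in [C]; hence only
    an [a] carrying some point of [C] into [C] contributes. *)
Lemma integral_shift_le (a : dual R G) :
  \int[nu]_(w in (C : set (borel (dual R G))))
    ((Normc.normc (F ((w : dual R G) + a)%R * g w)) ^+ 2)%:E
  <= (b * \1_[set a | exists2 w, C w & C (w + a)%R] a)%:E *
     \int[nu]_(w in (C : set (borel (dual R G)))) ((Normc.normc (g w)) ^+ 2)%:E.
Proof.
set A := [set a | _].
have mgC : measurable_fun (C : set (borel (dual R G)))
    (fun w => ((Normc.normc (g w)) ^+ 2)%:E).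
  exact/measurable_funTS/measurable_sqr_normc.
have bA0 : (0 <= b * \1_A a)%R by rewrite mulr_ge0.
rewrite -ge0_integralZl//; last by move=> w _; rewrite lee_fin sqr_ge0.
apply: ae_ge0_le_integral => //.
- by move=> w _; rewrite lee_fin sqr_ge0.
- under eq_fun do rewrite normcM_sqr EFinM.
  apply: measurable_funTS; apply: emeasurable_funM.
    exact/measurable_sqr_normc/cmeasurable_dual_shift.
  exact: measurable_sqr_normc.
- by move=> w _; rewrite mule_ge0// lee_fin ?sqr_ge0.
- by apply: emeasurable_funM => //; exact: measurable_cst.
have := @ae_dual_shift R G nu nu_haar
  (fun w => ((Normc.normc (F w)) ^+ 2 <= b * \1_C w)%R) a Fb.
apply: filterS => w Fw Cw; rewrite normcM_sqr -EFinM lee_fin.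
rewrite ler_wpM2r ?sqr_ge0// (le_trans Fw)// ler_wpM2l// !indicE.
have [/set_mem Cwa|] := boolP ((w : dual R G) + a \in C)%R; last by rewrite ler0n.
by rewrite mem_set//; exists w.
Qed.

Lemma esum_annihilator_integral_le (D : {fset dual R G}) :
  C `<=` \bigcup_(w in [set` D]) dual_coset H w ->
  \esum_(a in annihilator K) \int[nu]_(w in (C : set (borel (dual R G))))
    ((Normc.normc (F ((w : dual R G) + a)%R * g w)) ^+ 2)%:E
  <= n%:R%:E * (((size D * size D)%:R * b)%:E *
     \int[nu]_(w in (C : set (borel (dual R G)))) ((Normc.normc (g w)) ^+ 2)%:E).
Proof.
move=> CD; set X := \int[nu]_(w in _) ((Normc.normc (g w)) ^+ 2)%:E.
have X0 : 0 <= X by apply: integral_ge0 => w _; rewrite lee_fin sqr_ge0.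
have bX0 : 0 <= b%:E * X by rewrite mule_ge0.
(* If [w] and [w + a] lie in the cosets of [v] and [v'], then [a] lies in the coset of [v' - v].
   Entries of [DD] may represent the same coset, which is harmless for an upper bound. *)
pose DD := [seq (v - w)%R | v <- D, w <- D].
apply: (@le_trans _ _ (\esum_(a in annihilator K)
    \sum_(u <- DD) (if a \in dual_coset H u then b%:E * X else 0))).
  apply: le_esum => a _; apply: le_trans (integral_shift_le a) _.
  rewrite indicE; have [/set_mem[w Cw Cwa]|_] := boolP (a \in _); last first.
    by rewrite mulr0 mul0e; apply: sume_ge0 => u _; case: ifPn.
  have [v /= vD vw] := CD _ Cw; have [v' /= v'D vw'] := CD _ Cwa.
  have uDD : (v' - v)%R \in DD by apply/allpairsP; exists (v', v).
  rewrite mulr1 (big_rem _ uDD)/= ifT; last first.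
    apply/mem_set; rewrite /dual_coset /=.
    have -> : (a - (v' - v) = (w + a - v') + - (w - v))%R.
      rewrite !opprB [(w + a)%R]addrC -!addrA; congr (a + _)%R.
      by rewrite [RHS]addrCA [(w + _)%R]addrC subrK addrC.
    by apply: annihilatorD => //; exact: annihilatorN.
  by rewrite leeDl//; apply: sume_ge0 => u _; case: ifPn.
rewrite esum_sum; last by move=> a u _ _; case: ifPn.
apply: le_trans (lee_sum _ (fun u _ => esum_annihilator_coset H_open index_n u bX0)) _.
rewrite sume_const ?mule_ge0// ?lee_fin// size_allpairs.
by rewrite muleCA EFinM -!muleA.
Qed.

End upper_bound.

Close Scope ereal_scope.

(** * The local integrability condition *)

Section covolume_inverse.
Local Open Scope ereal_scope.

(** For finite positive [d] the inverse is that of a nonzero real, so [n] cancels even when [Y] is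
    infinite. *)
Lemma inve_covolume (R : realType) (n : nat) (d Y : \bar R) :
  (0 < n)%N -> 0 < d -> d < +oo -> (n%:R%:E * d)^-1 * (n%:R%:E * Y) = d^-1 * Y.
Proof.
move=> n0; case: d => // r; rewrite lte_fin => r0 _.
have n0' : (n%:R != 0 :> R)%R by rewrite pnatr_eq0 -lt0n.
rewrite -EFinM !inver mulf_eq0 (negbTE n0') !gt_eqF//= muleA -EFinM.
by congr (_%:E * _); field; rewrite n0' gt_eqF.
Qed.

End covolume_inverse.

Section gti.
Variables (R : realType) (G : topologicalZmodType).
Variables (mu : {measure set (borel G) -> \bar R}).
Variables (nu : {measure set (borel (dual R G)) -> \bar R}).
Hypothesis nu_haar : is_haar nu.
Variables (J : countType) (S : gti_system mu J).
Variable ghat : forall j, gti_P S j -> borel (dual R G) -> R[i].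
Hypothesis mghat : forall j, cmeasurable
  (fun pw : (gti_P S j * borel (dual R G))%type => ghat pw.1 pw.2).
Local Open Scope ereal_scope.

Let f j (pw : (gti_P S j * borel (dual R G))%type) : \bar R :=
  ((Normc.normc (ghat pw.1 pw.2)) ^+ 2)%:E.

Let mf j : measurable_fun setT (@f j).
Proof. exact: measurable_sqr_normc. Qed.

Let f0 j pw : 0 <= @f j pw.
Proof. by rewrite lee_fin sqr_ge0. Qed.

Lemma cmeasurable_section j (p : gti_P S j) : cmeasurable (ghat p).
Proof.
have [mRe mIm] := mghat j; split.
  exact: (measurableT_comp mRe (measurable_pair1 p)).
exact: (measurableT_comp mIm (measurable_pair1 p)).
Qed.

Let mG j : measurable_fun setT
  (fun w : borel (dual R G) => \int[gti_muP S j]_p @f j (p, w)).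
Proof.
exact: (@measurable_fun_fubini_tonelli_G _ _ _ _ _ (gti_muP S j) (@f j)).
Qed.

Variable d : J -> \bar R.
Hypothesis d0 : forall j, 0 < d j.

Let dV j : 0 <= (d j)^-1.
Proof. by rewrite inve_ge0 ltW. Qed.

Let mdG j : measurable_fun setT
  (fun w : borel (dual R G) => (d j)^-1 * \int[gti_muP S j]_p @f j (p, w)).
Proof. by apply: measurable_funeM; exact: mG. Qed.

Let dG0 j w : 0 <= (d j)^-1 * \int[gti_muP S j]_p @f j (p, w).
Proof. by rewrite mule_ge0//; exact: integral_ge0. Qed.

Lemma measurable_weighted_transform_sum :
  measurable_fun setT (weighted_transform_sum d ghat).
Proof. exact: (measurable_esum mdG dG0). Qed.

Lemma weighted_transform_sum_ge0 w : 0 <= weighted_transform_sum d ghat w.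
Proof. by apply: esum_ge0 => j _; exact: dG0. Qed.

Lemma integral_weighted_transform_sum (C : set (borel (dual R G))) :
    measurable C -> nu C < +oo ->
  \int[nu]_(w in C) weighted_transform_sum d ghat w =
  \esum_(j in [set: J]) ((d j)^-1 * \int[gti_muP S j]_p \int[nu]_(w in C)
    ((Normc.normc (ghat p w)) ^+ 2)%:E).
Proof.
move=> mC Coo; rewrite (@integral_esum _ _ _ _ nu C mC
  (fun j w => (d j)^-1 * \int[gti_muP S j]_p @f j (p, w)))//; last first.
  by move=> j; exact: measurable_funTS.
apply: eq_esum => j _; rewrite ge0_integralZl//.
- by congr (_ * _); rewrite -(tonelli_restricted _ mC Coo (@mf j) (@f0 j)).
- by apply: measurable_funTS; exact: mG.
- by move=> w _; exact: integral_ge0.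
Qed.

Lemma measurable_section_integral (C : set (borel (dual R G))) j :
    measurable C -> nu C < +oo ->
  measurable_fun setT (fun p : gti_P S j => \int[nu]_(w in C)
    ((Normc.normc (ghat p w)) ^+ 2)%:E).
Proof.
move=> mC Coo.
exact: (@measurable_integral_restricted _ _ _ _ _ nu C mC Coo (@f j)).
Qed.

End gti.

Lemma integral_cover_lty d (T : measurableType d) (R : realType)
    (mu : {measure set T -> \bar R}) (I : choiceType) (D : {fset I})
    (A : set T) (C : I -> set T) (f : T -> \bar R) :
    measurable A -> (forall i, measurable (C i)) -> measurable_fun setT f ->
    (forall x, 0 <= f x)%E -> A `<=` \bigcup_(i in [set` D]) C i ->
    (forall i, \int[mu]_(x in C i) f x < +oo)%E ->
  (\int[mu]_(x in A) f x < +oo)%E.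
Proof.
move=> mA mC mf f0 AC fC; rewrite integral_mkcond.
have mfC (B : set T) : measurable B -> measurable_fun setT (f \_ B).
  by move=> mB; apply/(measurable_restrictT _ mB); exact: measurable_funTS.
have fB0 (B : set T) x : (0 <= (f \_ B) x)%E by rewrite patchE; case: ifPn.
apply: (@le_lt_trans _ _ (\int[mu]_x \sum_(i <- D) (f \_ (C i)) x)%E).
  apply: ge0_le_integral => //; first exact: mfC.
    by apply: emeasurable_sum => i; exact: mfC.
  move=> x _; rewrite {1}patchE; case: ifPn => [/set_mem Ax|_]; last first.
    by apply: sume_ge0 => i _; exact: fB0.
  have [i /= iD Cx] := AC x Ax.
  rewrite (big_rem _ iD)/= {1}patchE mem_set// leeDl//.
  by apply: sume_ge0 => k _; exact: fB0.
rewrite ge0_integral_sum//; last by move=> i; exact: mfC.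
by apply: lte_sum_pinfty => i _; rewrite -integral_mkcond.
Qed.

(** The constant is the square of the essential supremum; the indicator reflects that [F] vanishes
    almost everywhere off its essential support. *)
Lemma ess_bounded (R : realType) (G : topologicalZmodType)
    (nu : {measure set (borel (dual R G)) -> \bar R})
    (F : borel (dual R G) -> R[i]) :
    @second_countable G -> is_haar nu -> cLfun nu +oo F ->
  exists2 b : R, 0 <= b & {ae nu, forall w : borel (dual R G),
    (Normc.normc (F w)) ^+ 2 <= b * \1_(ess_supp nu F) w}.
Proof.
move=> G2 [_ _ nu_pos] [mF]; rewrite /cLnorm unlock /Lnorm ifT; last first.
  (* The norm at [+oo] is the essential supremum only on a space of positive mass, by convention 0
     otherwise. *)
  by apply: nu_pos; [exact: openT|exists 0].
set e := ess_sup _ _ => eoo.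
have eP := @ess_sup_ge _ _ _ nu (abse \o (fun x => (Normc.normc (F x))%:E)).
exists (fine e ^+ 2); first exact: sqr_ge0.
move: eP (ae_ess_supp nu G2 mF); apply: filterS2 => w /= we wF.
have [wK|wK] := pselect (ess_supp nu F w); last first.
  by rewrite wF// Normc.normc0 expr0n/= mulr_ge0// sqr_ge0.
rewrite indicE mem_set// mulr1.
have n0 : 0 <= Normc.normc (F w) by rewrite -lecR; exact: (normr_ge0 (F w)).
have we' : Normc.normc (F w) <= fine e.
  by move: we; rewrite -/e ger0_norm//; case: e eoo => //= r _; rewrite ?lee_fin.
by rewrite lerXn2r ?nnegrE// (le_trans n0).
Qed.

Theorem theorem4p4 (R : realType) (G : topologicalZmodType)
  (G_second_countable : @second_countable G)
  (G_locally_compact : locally_compact [set: G])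
  (G_hausdorff : hausdorff_space G)
  (H : zmodClosed G)
  (H_compact : compact [set` H])
  (H_open : open [set` H])
  (mu : {measure set (borel G) -> \bar R})
  (mu_haar : is_haar mu)
  (mu_H : mu [set` H] = 1%E)
  (nu : {measure set (borel (dual R G)) -> \bar R})
  (nu_plancherel : is_plancherel_measure mu nu)
  (J : countType)
  (S : gti_system mu J)
  (* G / Gamma_j *)
  (muQ : forall j, {measure set (borel (quotient (gti_Gamma S j))) -> \bar R})
  (muQ_haar : forall j, is_haar (muQ j))
  (muQ_weil : forall j,
    weil (\val : subgroup (gti_Gamma S j) -> G) mu (gti_muGamma S j) (muQ j))
  (* H + Gamma_j *)
  (muHG : forall j,
    {measure set (borel (subgroup (subgroup_sum H (gti_Gamma S j)))) -> \bar R})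
  (muHG_haar : forall j, is_haar (muHG j))
  (muHG_weil : forall j,
    weil (S := subgroup_sum H (gti_Gamma S j))
      (\val : subgroup (subgroup_sum H (gti_Gamma S j)) -> G)
      mu (muHG j) counting)
  (* (H + Gamma_j) / Gamma_j *)
  (muHQ : forall j,
    {measure set (borel (quotient (sumr H (gti_Gamma S j)))) -> \bar R})
  (muHQ_haar : forall j, is_haar (muHQ j))
  (muHQ_weil : forall j,
    weil (@subgroup_sumr G H (gti_Gamma S j))
      (muHG j) (gti_muGamma S j) (muHQ j))
  (ghat : forall j, gti_P S j -> borel (dual R G) -> R[i])
  (ghat_transform : is_gti_transform nu ghat) :
  local_integrability nu (fun j => covolume (muQ j)) ghat <->
  L1_loc nu (weighted_transform_sum (fun j => covolume (muHQ j)) ghat).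

Proof.
have nu_haar := nu_plancherel.1; have mghat := ghat_transform.2.
have /choice[n nP] j : exists n,
    ([set: quotient (subgroup_sum H (gti_Gamma S j))] #= `I_n)%card.
  by apply/finite_setP/(finite_index H_open); exact: gti_cocompact.
have n_gt0 j : (0 < n j)%N.
  rewrite lt0n; apply/eqP => nj0; have := nP j.
  by rewrite nj0 II0 card_eq0 => /eqP/seteqP[/(_ 0)] + _; apply.
have dE j : covolume (muQ j) = ((n j)%:R%:E * covolume (muHQ j))%E.
  exact: (covolume_sum H_open mu_haar mu_H (gti_haar S j) (muHG_haar j)
    (@muQ_weil j) (@muHG_weil j) (@muHQ_weil j) (nP j)).
have dH_gt0 j : (0 < covolume (muHQ j))%E.
  by have [_ _] := muHQ_haar j; apply; [exact: openT|exists 0].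
(* An infinite value would make its product with the positive index infinite, whereas that product
   is the mass of the compact group G / Gamma_j. *)
have dH_lty j : (covolume (muHQ j) < +oo)%E.
  have [_ /(_ _ (@gti_cocompact _ _ _ _ S j)) + _] := muQ_haar j.
  rewrite -[X in (X < _)%E -> _]/(covolume (muQ j)) dE.
  case: covolume => [r _| |//]; first exact: ltry.
  by rewrite gt0_muley ?ltxx// lte_fin ltr0n.
have mW := measurable_weighted_transform_sum mghat dH_gt0.
have W0 := @weighted_transform_sum_ge0 R G mu J S ghat _ dH_gt0.
split=> [LI K cK|L1 f F Ff fF Foo cK].
  have mK : measurable (K : set (borel (dual R G))).
    by apply: borel_closed; apply: compact_closed => //; exact: dual_hausdorff.
  (* The local integrability condition for the function whose transform is the
     indicator of the coset of [w0] modulo the annihilator of [H]. *)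
  have W_coset w0 : (\int[nu]_(w in dual_coset H w0)
      weighted_transform_sum (fun j => covolume (muHQ j)) ghat w < +oo)%E.
    have := LI _ _ (cLfun_restrict_character H_open mu_H w0 (@ltr0Sn R 1))
      (fourier_plancherel_coset_indicator H_compact H_open mu_haar mu_H nu_haar w0)
      (cLfun_coset_indicator_oo nu H_compact w0).
    rewrite (ess_supp_coset_indicator H_compact nu_haar w0).
    move=> /(_ (@dual_coset_compact R G H H_open w0)); apply: le_lt_trans.
    have mC := dual_coset_measurable H_compact w0.
    have Coo := dual_coset_finite H_open nu_haar w0.
    rewrite integral_weighted_transform_sum//; apply: le_esum => j _.
    rewrite dE [X in (_ <= _ * X)%E](_ : _ = ((n j)%:R%:E * \int[gti_muP S j]_p
      \int[nu]_(w in dual_coset H w0) ((Normc.normc (ghat j p w)) ^+ 2)%:E)%E).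
      by rewrite inve_covolume.
    rewrite -ge0_integralZl//; last 2 first.
    - exact: measurable_section_integral.
    - by move=> p _; apply: integral_ge0 => w _; rewrite lee_fin sqr_ge0.
    apply: eq_integral => p _; rewrite -(esum_annihilator H_open (nP j)); last first.
      by apply: integral_ge0 => w _; rewrite lee_fin sqr_ge0.
    (* For [w] in the coset of [w0], the point [w + a] stays there exactly when [a] annihilates [H];
       each term is thus the full integral of the squared modulus of [ghat j p], or 0. *)
    apply: eq_esum => a _; have [/set_mem aH|aH] := boolP (a \in _).
      apply: eq_integral => w /set_mem w0w; rewrite normcM_sqr.
      rewrite normc_coset_indicator indicE mem_set ?expr1n ?mul1r//.
      by apply/(dual_cosetP _ w0w); rewrite addrAC subrr add0r.
    apply: integral0_eq => w w0w; rewrite normcM_sqr.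
    rewrite normc_coset_indicator indicE memNset ?expr0n ?mul0r//.
    move=> /(dual_cosetP _ w0w); rewrite addrAC subrr add0r => /mem_set aH'.
    by rewrite aH' in aH.
  apply/integrableP; split; first exact: measurable_funTS.
  under eq_integral do rewrite gee0_abs//.
  have [D KD] := compact_dual_cosets H_compact cK.
  apply: (integral_cover_lty mK _ mW _ KD W_coset) => //.
  by move=> w; exact: dual_coset_measurable.
set C := ess_supp nu F in cK *.
have mC : measurable (C : set (borel (dual R G))).
  by apply: borel_closed; apply: compact_closed => //; exact: dual_hausdorff.
have Coo : (nu C < +oo)%E by have [_ nuK _] := nu_haar; exact: nuK.
have /integrableP[_] := L1 C cK.
under eq_integral do rewrite gee0_abs//.
rewrite integral_weighted_transform_sum// => LI.
have [b b0 Fb] := ess_bounded G_second_countable nu_haar Foo.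
have [D CD] := compact_dual_cosets H_compact cK.
(* The number of cosets that can contain a contributing [a], times the bound on the squared modulus
   of [F]; it does not depend on [j], so it factors out of the sum. *)
pose M := (size D * size D)%:R * b.
have M0 : 0 <= M by rewrite mulr_ge0.
pose Y j := (\int[gti_muP S j]_p
  \int[nu]_(w in C) ((Normc.normc (ghat j p w)) ^+ 2)%:E)%E.
have X0 j p : (0 <= \int[nu]_(w in C) ((Normc.normc (ghat j p w)) ^+ 2)%:E)%E.
  by apply: integral_ge0 => w _; rewrite lee_fin sqr_ge0.
have Y0 j : (0 <= Y j)%E by exact: integral_ge0.
have mX j := @measurable_section_integral R G mu nu J S ghat mghat C j mC Coo.
apply: (@le_lt_trans _ _ (\esum_(j in [set: J])
    (M%:E * ((covolume (muHQ j))^-1 * Y j)))%E); last first.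
  rewrite esumZl// ?lte_mul_pinfty// => j.
  by rewrite mule_ge0// inve_ge0 ltW.
apply: le_esum => j _; rewrite dE.
(* The index is reinserted on the right so that both sides carry the same weight, which leaves a
   comparison of integrals over [p]. *)
rewrite muleCA -(inve_covolume _ (n_gt0 j) (dH_gt0 j) (dH_lty j)).
apply: lee_wpmul2l; first by rewrite inve_ge0 mule_ge0// ltW.
rewrite /Y -ge0_integralZl// -ge0_integralZl//; last 2 first.
- exact: measurable_funeM.
- by move=> p _; rewrite mule_ge0.
apply: ge0_le_integral_nomeas => p.
  by apply: esum_ge0 => a _; apply: integral_ge0 => w _; rewrite lee_fin sqr_ge0.
have mg := cmeasurable_section mghat p.
have [mF _] := Foo.
exact: (esum_annihilator_integral_le H_open (nP j) nu_haar mF mg b0 mC Fb CD).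
Qed.
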